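(* Let $n\ge 2$ and let $S_n$ be the permutation group on $n$ letters. Fix $\theta$ with $0<\theta\le 1$. Let $K$ be the systematic scan Metropolis chain on $S_n$ with parameter $\theta$, let $\pi$ be its stationary distribution $\pi(w)=\theta^{-\ell(w)}/\sum_{v\in S_n}\theta^{-\ell(v)}$, and write $K_1^\ell(w)=K^\ell(\mathrm{id},w)$. If $\theta<1$ and the number of scans is $\ell=n/2-(\log n)/(\log\theta)+c$ with $c>0$, then $$\Vert K_1^\ell-\pi\Vert_{TV}^2\le\left(e^{\theta^{2c+1}}-1\right)+n!\,\theta^{\,n^2/8-n(\log n)/(\log\theta)+n(c+1/4)}.$$ Conversely, if $\ell=\ell_n\le n/4$ then, for fixed $\theta$, $\Vert K_1^{\ell}-\pi\Vert_{TV}$ tends to $1$ as $n\to\infty$.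
   Context: $S_n$ is generated by the simple transpositions $s_i=(i,i+1)$, $1\le i\le n-1$; the length $\ell(w)$ of $w\in S_n$ is the smallest $k$ such that $w=s_{i_1}\cdots s_{i_k}$. The symbol $\ell$ without argument denotes a number of scans (a nonnegative integer). For each $i$ the elementary Metropolis step $K_i$ is: from $w$, if $\ell(s_iw)>\ell(w)$ move to $s_iw$; if $\ell(s_iw)<\ell(w)$ move to $s_iw$ with probability $\theta$ and stay at $w$ with probability $1-\theta$. One systematic scan performs the elementary steps for $s_1,s_2,\ldots,s_{n-1},s_{n-1},\ldots,s_2,s_1$, in this order; $K(w,w')$ is the probability that a systematic scan started at $w$ ends at $w'$, and $K^\ell(w,w')=\sum_{w''}K^{\ell-1}(w,w'')K(w'',w')$. For probability distributions $\mu,\nu$ on a finite set $X$, $\Vert\mu-\nu\Vert_{TV}=\max_{A\subseteq X}|\mu(A)-\nu(A)|=\frac12\sum_{x\in X}|\mu(x)-\nu(x)|$. *)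

(* Defs.v *)
From mathcomp Require Import all_boot all_order all_algebra all_fingroup.
From mathcomp Require Import all_classical all_reals all_analysis.

Set Implicit Arguments.
Unset Strict Implicit.
Unset Printing Implicit Defensive.

Import Order.TTheory GRing.Theory Num.Theory.

Local Open Scope ring_scope.

Fact gen_ltn n (i : 'I_n.-1) : (i.+1 < n)%N.
Proof. by rewrite -ltn_predRL. Qed.

(* The letters are 0, ..., n-1, so the generator with index i : 'I_n.-1 is
   the transposition usually written s_(i+1). *)
Definition simple_tperm n (i : 'I_n.-1) : 'S_n :=
  tperm (Ordinal (ltnW (gen_ltn i))) (Ordinal (gen_ltn i)).

Definition is_word n (w : 'S_n) (k : nat) : bool :=
  [exists t : k.-tuple 'I_n.-1, w == (\prod_(i <- t) simple_tperm i)%g].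

Section Words.
Variable n : nat.
Implicit Types w u v : 'S_n.

Let W w := exists s : seq 'I_n.-1, w = (\prod_(i <- s) simple_tperm i)%g.

Let W1 : W 1%g.
Proof. by exists [::]; rewrite big_nil. Qed.

Let WM u v : W u -> W v -> W (u * v)%g.
Proof. by move=> [s ->] [t ->]; exists (s ++ t); rewrite big_cat. Qed.

Let W_tperm_lt d : forall i j : 'I_n, (j = i + d :> nat)%N -> W (tperm i j).
Proof.
elim: d => [|d IHd] i j ij.
  by rewrite (_ : j = i) ?tperm1//; apply/val_inj; rewrite /= ij addn0.
have jn : ((i + d).+1 < n)%N by rewrite -addnS -ij.
pose k : 'I_n := Ordinal (ltnW jn).
have kn : (i + d < n.-1)%N by rewrite ltn_predRL.
have Wkj : W (tperm k j).
  exists [:: Ordinal kn]; rewrite big_seq1 /simple_tperm.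
  by congr tperm; apply/val_inj; rewrite //= ij addnS.
case: d => [|d] in IHd jn k kn ij Wkj *.
  by rewrite (_ : i = k)//; apply/val_inj; rewrite /= addn0.
have Wik : W (tperm i k) by apply: IHd.
have -> : tperm i j = (tperm k j * tperm i k * tperm k j)%g.
  have -> : (tperm k j * tperm i k * tperm k j = tperm i k ^ tperm k j)%g.
    by rewrite /conjg tpermV mulgA.
  rewrite tpermJ tpermL tpermD//.
    by rewrite -val_eqE /= gtn_eqF// -[ltnLHS]addn0 ltn_add2l.
  by rewrite -val_eqE /= ij gtn_eqF// -[ltnLHS]addn0 ltn_add2l.
by do 2?apply: WM.
Qed.

Let W_tperm i j : W (tperm i j).
Proof.
have [ij|/ltnW ji] := leqP i j.
  by apply: (@W_tperm_lt (j - i)); rewrite subnKC.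
by rewrite tpermC; apply: (@W_tperm_lt (i - j)); rewrite subnKC.
Qed.

Lemma is_word_ex w : exists k, is_word w k.
Proof.
suff [s ws] : W w.
  by exists (size s); apply/existsP; exists (in_tuple s); apply/eqP.
have [ts -> _] := prod_tpermP w.
by elim: ts => [|t ts IH]; rewrite ?big_nil// big_cons; apply: WM.
Qed.

End Words.

Definition perm_length n (w : 'S_n) : nat := ex_minn (is_word_ex w).

(* Transition kernels on a finite set, as row-stochastic matrices: P x y is the
   probability of going from x to y, and trans_comp P Q performs P first. *)
Definition trans_kernel (R : realType) (T : finType) := T -> T -> R.

Definition trans_id (R : realType) (T : finType) : trans_kernel R T :=
  fun x y => (x == y)%:R.

Definition trans_comp (R : realType) (T : finType) (P Q : trans_kernel R T) :
    trans_kernel R T :=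
  fun x y => \sum_z P x z * Q z y.

Definition trans_pow (R : realType) (T : finType) (P : trans_kernel R T)
    (l : nat) : trans_kernel R T :=
  iter l (fun Q => trans_comp Q P) (@trans_id R T).

Definition metropolis_step (R : realType) (theta : R) n (i : 'I_n.-1) :
    trans_kernel R 'S_n :=
  fun w w' =>
    let v := (simple_tperm i * w)%g in
    if (perm_length w < perm_length v)%N then (w' == v)%:R
    else theta * (w' == v)%:R + (1 - theta) * (w' == w)%:R.

Definition scan_order n : seq 'I_n.-1 := enum 'I_n.-1 ++ rev (enum 'I_n.-1).

Definition systematic_scan (R : realType) (theta : R) n : trans_kernel R 'S_n :=
  foldr (@trans_comp R 'S_n) (@trans_id R 'S_n)
    [seq metropolis_step theta i | i <- scan_order n].
Arguments systematic_scan {R} theta n _ _.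

Definition stationary_dist (R : realType) (theta : R) n (w : 'S_n) : R :=
  theta ^- perm_length w / \sum_(v : 'S_n) theta ^- perm_length v.
Arguments stationary_dist {R} theta n w.

Definition tv_dist (R : realType) (T : finType) (mu nu : T -> R) : R :=
  \big[Num.max/0]_(A : {set T}) `|\sum_(x in A) mu x - \sum_(x in A) nu x|.

(* Main.v *)
Require Import Defs.
From mathcomp Require Import all_boot all_order all_algebra all_fingroup.
From mathcomp Require Import all_classical all_reals all_analysis.
From mathcomp Require Import complex zify ring lra.
From HB Require Import structures.
Import Order.TTheory GRing.Theory Num.Theory numFieldNormedType.Exports.

(** Upper bound.  Conjugation by the square root of the stationary distribution
   turns the elementary steps into symmetric matrices that satisfy the relations
   of the Iwahori-Hecke algebra, with quadratic relation
   g^2 = (1 - theta) g + theta, and it turns a scan into a Jucys-Murphy element J.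
   With e the basis vector of the identity permutation and Z the sum of
   theta^-length, Cauchy-Schwarz bounds 4 TV^2 by Z |e J^l|^2 - 1 (tv_dist_chi2,
   scan_chi2), so what matters is how e is distributed over the spectrum of J.
   Put r = n - 1, number the r generators starting from the end of the scan, and
   let W_j be the submodule generated by the space F_j of the vectors invariant
   under the first j generators.

   - On the orthogonal complement of W_j, J is at most theta^(r-j+1): each
     generator added to a Jucys-Murphy element lowers its norm by a factor theta,
     unless some vector is invariant under all the generators met so far
     (jucys_murphy_contract, jucys_murphy_decay).  This replaces the computation
     of the spectrum by contents of Young tableaux.

   - The projection of e on W_j is short.  The matrices that commute with the right
     multiplications form an algebra on which the coefficient at (e, e) is a trace
     (commutant_traceC).  On orthogonal projections it is a dimension function in
     the sense of Murray and von Neumann, hence subadditive (trace_le_size).  Now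
     W_j is a sum of at most n^(r-j) translates of F_j (generated_trace_le), and
     F_j has dimension at most 1 / Z_j, where Z_j is the sum of theta^-length over
     the permutations of the last j + 1 positions (invariants_trace_le).

   Comparing these sums, Z / Z_(r-k) <= (n theta^-(n-1))^k (tail_mass_le), so
   Z |e J^l|^2 is at most the sum over 0 <= k < n of x^k, with
   x = theta^(2l) n^2 theta^-(n-1) (scan_return_le).  For the given l,
   x = theta^(2c+1).  If x <= 3/4 then TV^2 <= x / (4 (1 - x)) <= x <= e^x - 1;
   otherwise e^x - 1 >= 1 >= TV^2 (scan_tv_le).

   Lower bound.  Let a = n/2, rounded down.  The number of letters >= a in the first
   a positions changes only when the letters on both sides of the boundary are
   exchanged, which may happen twice in a scan; but if the first visit has brought
   in a large letter, this letter still stands at the boundary during the second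
   visit, which then brings in no other one (carries_scan).  After l <= n/4 scans
   there are thus at most n/4 such letters.  A permutation of this kind has at least
   (n/4)^2 noninversions, up to rounding, so these permutations have stationary mass
   at most n! theta^((n/4)^2) (crossed_stationary_sum), which tends to 0 when
   theta < 1.  When theta = 1 the scan is the identity and the stationary
   distribution is uniform. *)

Set Implicit Arguments.
Unset Strict Implicit.
Unset Printing Implicit Defensive.

Local Open Scope ring_scope.

(** * Orthogonal projections and symmetric matrices *)

Section SquaredNorm.
Variables (R : rcfType) (N : nat).
Implicit Types (u v w : 'rV[R]_N).

Definition sqnorm v : R := (v *m v^T) 0 0.

Lemma sqnormE v : sqnorm v = \sum_i v 0 i ^+ 2.
Proof. by rewrite /sqnorm mxE; apply: eq_bigr => i _; rewrite mxE expr2. Qed.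

Lemma sqnorm_ge0 v : 0 <= sqnorm v.
Proof. by rewrite sqnormE sumr_ge0// => i _; rewrite sqr_ge0. Qed.

Lemma sqnorm_eq0 v : (sqnorm v == 0) = (v == 0).
Proof.
apply/eqP/eqP => [|->]; last by rewrite /sqnorm mul0mx mxE.
rewrite sqnormE => /psumr_eq0P v0; apply/rowP => i; rewrite mxE.
have /eqP := v0 (fun j _ => sqr_ge0 _) i isT.
by rewrite sqrf_eq0 => /eqP.
Qed.

Lemma sqnorm0 : sqnorm 0 = 0.
Proof. by rewrite /sqnorm mul0mx mxE. Qed.

Lemma sqnormZ a v : sqnorm (a *: v) = a ^+ 2 * sqnorm v.
Proof. by rewrite /sqnorm linearZ /= -scalemxAl -scalemxAr scalerA mxE. Qed.

Lemma sqnormD_orth u v : u *m v^T = 0 -> sqnorm (u + v) = sqnorm u + sqnorm v.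
Proof.
move=> uv0; have vu0 : v *m u^T = 0 by rewrite -[v]trmxK -trmx_mul uv0 trmx0.
by rewrite /sqnorm linearD /= mulmxDl !mulmxDr uv0 vu0 addr0 add0r mxE.
Qed.

End SquaredNorm.

(** The Gram matrix formula for the orthogonal projection onto the row space of
   U; vectors are rows, on which matrices act from the right. *)
HB.lock Definition orthproj (R : rcfType) (m N : nat) (U : 'M[R]_(m, N)) :
    'M[R]_N :=
  let B := row_base U in B^T *m invmx (B *m B^T) *m B.

Section OrthogonalProjection.
Variables (R : rcfType) (N : nat).

Lemma gram_unitmx r (B : 'M[R]_(r, N)) : row_free B -> B *m B^T \in unitmx.
Proof.
move=> Bf; rewrite -row_free_unit; apply: inj_row_free => v.
move=> /(congr1 (mulmx^~ v^T)); rewrite mul0mx mulmxA => vB.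
apply/eqP; rewrite -(mulmx_free_eq0 v Bf) -sqnorm_eq0 /sqnorm trmx_mul mulmxA.
by rewrite vB mxE.
Qed.

Variables (m : nat) (U : 'M[R]_(m, N)).

Lemma orthproj_sub : (orthproj U <= U)%MS.
Proof. by rewrite orthproj.unlock (submx_trans (submxMl _ _)) ?eq_row_base. Qed.

Lemma orthproj_id p (v : 'M[R]_(p, N)) : (v <= U)%MS -> v *m orthproj U = v.
Proof.
rewrite -(eq_row_base U) => /submxP[w ->]; rewrite orthproj.unlock /=.
have Bu := gram_unitmx (row_base_free U).
by move: (row_base U) Bu => B Bu; rewrite !mulmxA -(mulmxA w) mulmxK.
Qed.

Lemma trmx_orthproj : (orthproj U)^T = orthproj U.
Proof.
rewrite orthproj.unlock /=; move: (row_base U) => B.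
by rewrite !trmx_mul trmxK trmx_inv trmx_mul trmxK mulmxA.
Qed.

Lemma orthproj_idem : orthproj U *m orthproj U = orthproj U.
Proof. by rewrite orthproj_id ?orthproj_sub. Qed.

Lemma orthproj_eq0 p (v : 'M[R]_(p, N)) : v *m U^T = 0 -> v *m orthproj U = 0.
Proof.
move=> vU0; have /submxP[w BE] : (row_base U <= U)%MS by rewrite eq_row_base.
rewrite orthproj.unlock /=; move: (row_base U) BE => B BE.
by rewrite {1}BE trmx_mul -!mulmxA (mulmxA v) vU0 mul0mx.
Qed.

(** A symmetric matrix that stabilizes a subspace also stabilizes its orthogonal
   complement. *)
Lemma orthproj_comm (M : 'M[R]_N) :
  M^T = M -> stablemx U M -> comm_mx (orthproj U) M.
Proof.
move=> Msym UM; have PM : orthproj U *m M = orthproj U *m M *m orthproj U.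
  by rewrite orthproj_id// (submx_trans (submxMr _ orthproj_sub)).
have MP : M *m orthproj U = orthproj U *m M *m orthproj U.
  by have := congr1 trmx PM; rewrite !trmx_mul trmx_orthproj Msym mulmxA.
by rewrite /comm_mx PM MP.
Qed.

End OrthogonalProjection.

Section SymmetricSpectrum.
Variables (R : rcfType) (N : nat) (M : 'M[R]_N).
Hypothesis Msym : M^T = M.

Let step (F : fieldType) (A : 'M[F]_N) (u : 'rV[F]_N) x := u *m (A - x%:M).

(** Over the complex numbers M is hermitian, hence diagonalizable with real
   eigenvalues; the list s of these eigenvalues without repetition works. *)
Lemma symmetric_annihilator :
  exists2 s : seq R, uniq s &
    forall v : 'rV[R]_N, foldl (step M) v s = 0.
Proof.
pose toC : R -> R[i] := real_complex R; pose A := map_mx toC M.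
have Aherm : A \is hermsymmx.
  apply/is_hermitianmxP; rewrite expr0 scale1r; apply/matrixP => i j.
  by rewrite !mxE -[in RHS]Msym mxE; apply/esym/(@conjc_real R).
have /hermitian_normalmx/orthomx_spectralP := Aherm.
have := hermitian_spectral_diag_real Aherm.
set P := spectralmx A; set d := spectral_diag A => dreal AE.
have Pu : P \in unitmx by exact: spectral_unit.
pose s := undup [seq complex.Re (d 0 j) | j : 'I_N].
exists s; first exact: undup_uniq.
move=> v; apply: (@map_mx_inj _ _ (real_complex R)); rewrite map_mx0.
have -> : map_mx toC (foldl (step M) v s) =
          foldl (step A) (map_mx toC v) (map toC s).
  elim: s v => //= x s IHs v; rewrite IHs; congr foldl.
  by rewrite /step map_mxM map_mxB map_scalar_mx.
rewrite -(mulmxKV Pu (map_mx toC v)); move: (_ *m invmx P) => w.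
have -> : forall t, foldl (step A) (w *m P) t = foldl (step (diag_mx d)) w t *m P.
  move=> t; elim: t w => //= x t IHt w; rewrite -IHt; congr foldl.
  rewrite /step AE !mulmxBr mulmxBl !mulmxA mulmxK//.
  by rewrite !mul_mx_scalar scalemxAl.
suff -> : foldl (step (diag_mx d)) w (map toC s) = 0 by rewrite mul0mx.
apply/rowP => j; rewrite mxE.
have -> : forall t, foldl (step (diag_mx d)) w t 0 j =
                    w 0 j * \prod_(x <- t) (d 0 j - x).
  move=> t; elim: t w => [|x t IHt] w /=; first by rewrite big_nil mulr1.
  rewrite IHt big_cons mulrA; congr (_ * _).
  by rewrite /step mulmxBr mul_mx_diag mul_mx_scalar !mxE mulrBr [w 0 j * x]mulrC.
have ds : d 0 j \in map toC s.
  apply/mapP; exists (complex.Re (d 0 j)).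
    by rewrite mem_undup; apply/mapP; exists j; rewrite ?mem_enum.
  by apply/esym/RRe_real; apply: mxOverP dreal 0 j.
by rewrite (big_rem _ ds) /= subrr mul0r mulr0.
Qed.

(** Dropping one linear factor of the annihilating product at a time splits a
   vector of V into orthogonal eigenvectors, all of which lie in V. *)
Lemma symmetric_norm_le m (V : 'M[R]_(m, N)) (c : R) :
  stablemx V M ->
  (forall z (u : 'rV[R]_N), (u <= V)%MS -> u *m M = z *: u -> u != 0 -> `|z| <= c) ->
  forall v : 'rV[R]_N, (v <= V)%MS -> sqnorm (v *m M) <= c ^+ 2 * sqnorm v.
Proof.
move=> VM Vc v; have [s us /(_ v)] := symmetric_annihilator.
have stepZ t (a : R) (u : 'rV[R]_N) : foldl (step M) (a *: u) t = a *: foldl (step M) u t.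
  by elim: t u => //= x t IHt u; rewrite -IHt /step -scalemxAl.
have stepB t (u w : 'rV[R]_N) :
    foldl (step M) (u - w) t = foldl (step M) u t - foldl (step M) w t.
  by elim: t u w => //= x t IHt u w; rewrite -IHt /step mulmxBl.
have stepV t u : (u <= V)%MS -> (foldl (step M) u t <= V)%MS.
  elim: t u => //= x t IHt u uV; apply: IHt; rewrite /step mulmxBr.
  rewrite mul_mx_scalar addmx_sub ?eqmx_opp ?scalemx_sub//.
  exact: submx_trans (submxMr _ uV) VM.
have stepE t u z : u *m M = z *: u ->
    foldl (step M) u t = (\prod_(x <- t) (z - x)) *: u.
  move=> uz; elim: t => [|x t IHt] /=; first by rewrite big_nil scale1r.
  by rewrite /step mulmxBr uz mul_mx_scalar -scalerBl stepZ IHt scalerA big_cons.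
have Mtr z (t : 'rV[R]_N) : t *m M = z *: t -> M *m t^T = z *: t^T.
  by move=> tz; rewrite -[in LHS]Msym -trmx_mul tz linearZ.
have extend (w t : 'rV[R]_N) z : (t <= V)%MS -> t *m M = z *: t ->
    w *m t^T = 0 -> sqnorm (w *m M) <= c ^+ 2 * sqnorm w ->
    sqnorm ((w + t) *m M) <= c ^+ 2 * sqnorm (w + t).
  move=> tV tM orth wc; rewrite mulmxDl (sqnormD_orth orth) mulrDr.
  rewrite sqnormD_orth; last first.
    by rewrite tM linearZ /= -scalemxAr -mulmxA (Mtr _ _ tM) -scalemxAr orth !scaler0.
  rewrite lerD// tM sqnormZ.
  have [->|t0] := eqVneq t 0; first by rewrite sqnorm0 !mulr0.
  have zc := Vc _ _ tV tM t0.
  rewrite ler_wpM2r ?sqnorm_ge0// -real_normK ?num_real//.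
  by rewrite lerXn2r ?nnegrE ?normr_ge0// (le_trans _ zc).
(* The orthogonality clause is what makes the induction go through: the part of
   w already treated is orthogonal to every later eigenvector. *)
suff split : forall w : 'rV[R]_N, (w <= V)%MS -> foldl (step M) w s = 0 ->
    sqnorm (w *m M) <= c ^+ 2 * sqnorm w /\
    forall z (u : 'rV[R]_N), u *m M = z *: u -> z \notin s -> w *m u^T = 0.
  by move=> v0 vV; have [] := split v vV v0.
elim/last_ind: s us {v} => [|s x IHs] us w wV.
  move=> /= ->; rewrite mul0mx; split=> [|z u _ _]; last by rewrite mul0mx.
  by rewrite sqnorm0 mulr0.
move: us; rewrite rcons_uniq => /andP[xs us].
rewrite -cats1 foldl_cat /=; set u := foldl _ _ _ => ux0.
have uM : u *m M = x *: u.
  by apply/eqP; rewrite -subr_eq0 -mul_mx_scalar -mulmxBr; apply/eqP.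
pose a := \prod_(y <- s) (x - y).
have a0 : a != 0.
  rewrite /a prodf_seq_neq0; apply/allP => y ys /=; rewrite subr_eq0.
  by apply: contraNneq xs => ->.
have aM : (a^-1 *: u) *m M = x *: (a^-1 *: u).
  by rewrite -scalemxAl uM scalerA mulrC -scalerA.
have aV : (a^-1 *: u <= V)%MS by rewrite scalemx_sub ?stepV.
have w'V : (w - a^-1 *: u <= V)%MS by rewrite addmx_sub ?eqmx_opp.
have w's : foldl (step M) (w - a^-1 *: u) s = 0.
  by rewrite stepB (stepE _ _ _ aM) -/u -/a scalerA mulfV ?scale1r ?subrr.
have [w'c w'orth] := IHs us _ w'V w's.
have orth := w'orth _ _ aM xs.
split; last first.
  move=> z t tz; rewrite mem_cat mem_seq1 negb_or => /andP[zs zx].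
  have /eqP := w'orth z t tz zs; rewrite mulmxBl subr_eq0 => /eqP ->.
  have : (x - z) *: ((a^-1 *: u) *m t^T) = 0.
    by rewrite scalerBl {1}scalemxAl -aM -mulmxA (Mtr _ _ tz) -scalemxAr subrr.
  by move/eqP; rewrite scaler_eq0 subr_eq0 eq_sym (negbTE zx) => /eqP.
by rewrite -[w](subrK (a^-1 *: u)); apply: extend aM _ _.
Qed.

End SymmetricSpectrum.

(** * Von Neumann dimension in a commutant with a trace *)

Section TracedCommutant.
Variables (R : rcfType) (N : nat) (I : Type) (S : I -> 'M[R]_N).
Hypothesis Ssym : forall i, (S i)^T = S i.

Definition commutant (a : 'M[R]_N) := forall i, comm_mx a (S i).

Definition is_orthproj (p : 'M[R]_N) := p^T = p /\ p *m p = p.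

Lemma commutantM a b : commutant a -> commutant b -> commutant (a *m b).
Proof. by move=> Ca Cb i; rewrite /comm_mx -mulmxA Cb !mulmxA Ca. Qed.

Lemma commutantD a b : commutant a -> commutant b -> commutant (a + b).
Proof. by move=> Ca Cb i; rewrite /comm_mx mulmxDl mulmxDr Ca Cb. Qed.

Lemma commutantN a : commutant a -> commutant (- a).
Proof. by move=> Ca i; rewrite /comm_mx mulNmx mulmxN Ca. Qed.

Lemma commutantB a b : commutant a -> commutant b -> commutant (a - b).
Proof. by move=> Ca Cb; apply/commutantD/commutantN. Qed.

Lemma commutant1 : commutant 1%:M.
Proof. by move=> i; rewrite /comm_mx mul1mx mulmx1. Qed.

Lemma commutant_tr a : commutant a -> commutant a^T.
Proof. by move=> Ca i; rewrite /comm_mx -{1}Ssym -trmx_mul -Ca trmx_mul Ssym. Qed.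

Lemma commutant_inv a : a \in unitmx -> commutant a -> commutant (invmx a).
Proof.
move=> au Ca i; rewrite /comm_mx -[RHS](mulKmx au) (mulmxA a) Ca.
by rewrite mulmxK// mulmxA.
Qed.

Lemma commutant_orthproj m (U : 'M[R]_(m, N)) :
  (forall i, stablemx U (S i)) -> commutant (orthproj U).
Proof. by move=> US i; apply: orthproj_comm. Qed.

Lemma orthprojP m (U : 'M[R]_(m, N)) : is_orthproj (orthproj U).
Proof. by split; [exact: trmx_orthproj | exact: orthproj_idem]. Qed.

Lemma orthprojB p q : is_orthproj p -> is_orthproj q -> q *m p = q ->
  is_orthproj (p - q).
Proof.
move=> [pT pp] [qT qq] qp; split; first by rewrite linearB /= pT qT.
have pq : p *m q = q by rewrite -[in LHS]pT -[in LHS]qT -trmx_mul qp.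
by rewrite mulmxBl !mulmxBr pp qp pq qq subrr subr0.
Qed.

(** The diagonal coefficient at o is assumed to be a trace on the commutant.
   Restricted to orthogonal projections it plays the role of a dimension. *)
Variable o : 'I_N.
Hypothesis traceC :
  forall a b, commutant a -> commutant b -> (a *m b) o o = (b *m a) o o.

Lemma orthproj_trace p : is_orthproj p -> p o o = sqnorm (row o p).
Proof.
move=> [pT pp]; rewrite -[in LHS]pp -[in X in _ *m X]pT /sqnorm.
by rewrite tr_row -row_mul !mxE; apply: eq_bigr => i _; rewrite !mxE.
Qed.

Lemma orthproj_trace_ge0 p : is_orthproj p -> 0 <= p o o.
Proof. by move=> /orthproj_trace ->; rewrite sqnorm_ge0. Qed.

(** Murray-von Neumann comparison: with f = orthproj y^T the support of y and
   z = y^T (y y^T + 1 - f)^-1 the pseudo-inverse, y z = f, whereas z y is an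
   orthogonal projection below e. *)
Lemma support_trace_le e y : is_orthproj e -> commutant e -> commutant y ->
  y *m e = y -> orthproj y^T o o <= e o o.
Proof.
move=> eP Ce Cy ye; set f := orthproj y^T; have [fT ff] := orthprojP y^T.
have fy : f *m y = y.
  by rewrite -[RHS]trmxK -(orthproj_id (submx_refl y^T)) trmx_mul fT trmxK.
have Cf : commutant f.
  apply: commutant_orthproj => i.
  by rewrite (commutant_tr Cy) submxMl.
pose M := y *m y^T + (1%:M - f).
have Mu : M \in unitmx.
  rewrite -row_free_unit; apply: inj_row_free => v vM.
  have gP : is_orthproj (1%:M - f).
    apply: orthprojB => //; first by split; rewrite ?trmx1 ?mulmx1.
    by rewrite mulmx1.
  have : sqnorm (v *m y) + sqnorm (v *m (1%:M - f)) = 0.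
    rewrite /sqnorm !trmx_mul gP.1 -!mulmxA (mulmxA (1%:M - f) _ v^T) gP.2.
    have : (v *m M *m v^T) 0 0 = 0 by rewrite vM mul0mx mxE.
    by rewrite mulmxDr mulmxDl -!mulmxA mxE.
  move/eqP; rewrite paddr_eq0 ?sqnorm_ge0// !sqnorm_eq0 => /andP[/eqP vy /eqP].
  rewrite mulmxBr mulmx1 => /eqP; rewrite subr_eq0 => /eqP ->.
  by apply: orthproj_eq0; rewrite trmxK.
have fM : (1%:M - f) *m M = 1%:M - f.
  rewrite mulmxDr mulmxA mulmxBl mul1mx fy subrr mul0mx add0r.
  by rewrite mulmxBr mulmx1 mulmxBl mul1mx ff subrr subr0.
have CM : commutant M.
  apply: commutantD; first exact/commutantM/commutant_tr.
  exact/commutantB/Cf/commutant1.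
pose z := y^T *m invmx M.
have Cz : commutant z.
  by apply: commutantM; [exact: commutant_tr | exact: commutant_inv].
have yz : y *m z = f.
  rewrite /z mulmxA -[y *m y^T](addrK (1%:M - f)) -/M mulmxBl mulmxV//.
  by rewrite -{1}fM mulmxK// opprB addrC subrK.
have MT : M^T = M.
  by rewrite /M linearD linearB /= trmx_mul trmxK trmx1 fT.
have gP : is_orthproj (z *m y).
  split; first by rewrite /z !trmx_mul trmxK trmx_inv MT mulmxA.
  by rewrite mulmxA -(mulmxA z) yz -mulmxA fy.
(* The trace identifies y z = f with the projection z y, which is below e. *)
have : 0 <= (e - z *m y) o o.
  by apply/orthproj_trace_ge0/orthprojB => //; rewrite -mulmxA ye.
by rewrite -yz traceC// !mxE subr_ge0.
Qed.

(** Subadditivity of the dimension p o o: when the maps v -> v x e, for x in xs,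
   embed the image of p into copies of the image of e, peel off from p the
   support of one of these maps at a time; each support is dominated by e. *)
Lemma trace_le_size (xs : seq 'M[R]_N) e p :
  is_orthproj e -> commutant e -> is_orthproj p -> commutant p ->
  {in xs, forall x, commutant x} ->
  (forall v : 'rV[R]_N, v *m p = v -> {in xs, forall x, v *m x *m e = 0} -> v = 0) ->
  p o o <= (size xs)%:R * e o o.
Proof.
move=> eP Ce; elim: xs p => [|x xs IHxs] p pP Cp Cxs inj.
  suff -> : p = 0 by rewrite mul0r mxE.
  apply/row_matrixP => i; rewrite row0; apply: inj => //.
  by rewrite -row_mul pP.2.
have Cx : commutant x by apply: Cxs; rewrite mem_head.
pose y := p *m x *m e; pose f := orthproj y^T.
have Cy : commutant y by do 2?apply: commutantM.
have fP : is_orthproj f by exact: orthprojP.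
have Cf : commutant f.
  by apply: commutant_orthproj => i; rewrite (commutant_tr Cy) submxMl.
have fp : f *m p = f.
  have /submxP[w fE] : (f <= y^T)%MS by exact: orthproj_sub.
  by rewrite fE /y !trmx_mul pP.1 -!mulmxA pP.2.
have pf : p *m f = f by rewrite -[in LHS]pP.1 -[in LHS]fP.1 -trmx_mul fp fP.1.
have yf : f *m y = y.
  by rewrite -[RHS]trmxK -(orthproj_id (submx_refl y^T)) trmx_mul fP.1 trmxK.
have := support_trace_le eP Ce Cy (_ : y *m e = y).
rewrite -/f /y -mulmxA eP.2 => /(_ erefl) fe.
have := IHxs (p - f) (orthprojB pP fP fp) (commutantB Cp Cf).
have -> : (p - f) o o = p o o - f o o by rewrite !mxE.
rewrite lerBlDr /= -natr1 mulrDl mul1r => le_pf.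
rewrite (le_trans (le_pf _ _)) ?lerD2l// => [t txs|v vpf vxs].
  by apply: Cxs; rewrite inE txs orbT.
have vp : v *m p = v by rewrite -vpf -mulmxA mulmxBl pP.2 fp.
have vf : v *m f = 0 by rewrite -vpf -mulmxA mulmxBl pf fP.2 subrr mulmx0.
apply: inj => // t; rewrite inE => /predU1P[->|/vxs//].
by rewrite -[v]vp -2!mulmxA (mulmxA p) -/y -yf mulmxA vf mul0mx.
Qed.

End TracedCommutant.

(** * Jucys-Murphy elements in a symmetric representation of the Hecke algebra *)

Section HeckeOperators.
Variables (R : rcfType) (N : nat) (theta : R).
Hypotheses (theta_gt0 : 0 < theta) (theta_le1 : theta <= 1).
Variables (r : nat) (g : nat -> 'M[R]_N).
Hypothesis gsym : forall i, (g i)^T = g i.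
Hypothesis gquad : forall i, g i *m g i = (1 - theta) *: g i + theta%:M.
Hypothesis gbraid : forall i, (i.+1 < r)%N ->
  g i *m g i.+1 *m g i = g i.+1 *m g i *m g i.+1.
Hypothesis gfar : forall i k, (i.+1 < k)%N -> comm_mx (g i) (g k).

Fixpoint jucys_murphy (m : nat) : 'M[R]_N :=
  if m is m'.+1 then g m' *m jucys_murphy m' *m g m' else 1%:M.
Local Notation J := jucys_murphy.

Lemma jucys_murphy_sym m : (J m)^T = J m.
Proof.
by elim: m => [|m IH] /=; rewrite ?trmx1// !trmx_mul gsym IH mulmxA.
Qed.

Lemma jucys_murphy_comm M m :
  (forall i, (i < m)%N -> comm_mx (g i) M) -> comm_mx (J m) M.
Proof.
elim: m => [|m IHm] gM /=; first exact/comm_mx_sym/comm_mx1.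
have JM : comm_mx (J m) M by apply: IHm => i im; apply: gM; apply: ltnW.
have gmM : comm_mx (g m) M by apply: gM.
by apply/comm_mx_sym/comm_mxM; [apply/comm_mxM|]; apply/comm_mx_sym.
Qed.

Lemma jucys_murphy_comm_high i m : (m < i)%N -> comm_mx (J m) (g i).
Proof. by move=> mi; apply: jucys_murphy_comm => k km; apply: gfar; lia. Qed.

Lemma braid_sandwich_comm (a b c : 'M[R]_N) :
  a *m b *m a = b *m a *m b -> comm_mx c b -> comm_mx (b *m (a *m c *m a) *m b) a.
Proof.
move=> br cb; rewrite /comm_mx -!mulmxA.
have brA (x : 'M[R]_N) : a *m (b *m (a *m x)) = b *m (a *m (b *m x)).
  by rewrite !mulmxA br.
by rewrite brA (mulmxA a b) br -!mulmxA (mulmxA c) cb -!mulmxA.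
Qed.

Lemma jucys_murphy_comm_low i m : (i.+1 < m <= r)%N -> comm_mx (J m) (g i).
Proof.
elim: m => [|m IHm] /andP[im mr] //.
have [im'|im'] : (m = i.+1 \/ i.+1 < m)%N by lia.
  rewrite im' /=; apply: braid_sandwich_comm; first by apply: gbraid; lia.
  exact: jucys_murphy_comm_high.
have gm : comm_mx (g i) (g m) by apply: gfar.
have Ji : comm_mx (J m) (g i) by apply: IHm; lia.
by apply/comm_mx_sym; do 2?apply: comm_mxM => //; apply/comm_mx_sym.
Qed.

Lemma jucys_murphy_commS m : (m < r)%N -> comm_mx (J m) (J m.+1).
Proof.
move=> mr; apply: jucys_murphy_comm => i im.
by apply/comm_mx_sym/jucys_murphy_comm_low; lia.
Qed.

(** The relation between consecutive Jucys-Murphy elements from which all the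
   spectral information is extracted. *)
Lemma jucys_murphyS_gen m :
  J m.+1 *m g m = (1 - theta) *: J m.+1 + theta *: (g m *m J m).
Proof.
by rewrite /= -mulmxA gquad mulmxDr -scalemxAr mul_mx_scalar.
Qed.

Lemma jucys_murphy_stable p (V : 'M[R]_(p, N)) m :
  (forall i, (i < m)%N -> stablemx V (g i)) -> stablemx V (J m).
Proof.
elim: m => [|m IHm] gV /=; first exact: stablemxC.
by rewrite !stablemxM ?gV ?IHm// => i im; apply/gV/ltnW.
Qed.

(** Passing from J m to J m.+1 gains a factor theta away from the invariant
   vectors: if J m.+1 had an eigenvalue z with |z| > theta * rho, the relation
   (u g) (z - theta J m) = (1 - theta) z u would make its eigenspace stable
   under g := g m.  There J m = z g^-2, so the eigenvalue - theta of g is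
   excluded as it would force |J m| >= |z| / theta^2; hence g m acts as 1, and
   by the braid relations so do all the g i with i <= m. *)
Lemma jucys_murphy_contract p (V : 'M[R]_(p, N)) m rho :
  (m < r)%N -> 0 <= rho -> (forall i, (i <= m)%N -> stablemx V (g i)) ->
  (forall v : 'rV[R]_N, (v <= V)%MS -> sqnorm (v *m J m) <= rho ^+ 2 * sqnorm v) ->
  (forall u : 'rV[R]_N, (u <= V)%MS -> (forall i, (i <= m)%N -> u *m g i = u) ->
     u = 0) ->
  forall v : 'rV[R]_N, (v <= V)%MS ->
    sqnorm (v *m J m.+1) <= (theta * rho) ^+ 2 * sqnorm v.
Proof.
move=> mr rho0 gV Jle fix0.
have JV : stablemx V (J m.+1) by apply: jucys_murphy_stable => i im; apply: gV.
have J'T := jucys_murphy_sym m.+1.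
have J'E : J m.+1 = g m *m J m *m g m by [].
have J'g := jucys_murphyS_gen m.
have J'J := jucys_murphy_commS mr.
have J'low i : (i < m)%N -> comm_mx (J m.+1) (g i).
  by move=> im; apply: jucys_murphy_comm_low; lia.
move: (J m.+1) JV J'T J'E J'g J'J J'low => J' JV J'T J'E J'g J'J J'low.
apply: (symmetric_norm_le J'T JV) => z u0 u0V u0z u0n0.
rewrite leNgt; apply/negP => z_large.
have z0 : z != 0.
  by rewrite -normr_gt0 (le_lt_trans _ z_large) ?mulr_ge0// ltW.
have JmV : stablemx V (J m) by apply: jucys_murphy_stable => i im; apply/gV/ltnW.
pose eig (u : 'rV[R]_N) := (u <= V)%MS /\ u *m J' = z *: u.
(* J m is at most rho on V, so z - theta J m and theta^2 J m - z are injective. *)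
have inj a (x : 'rV[R]_N) : 0 < a -> a <= theta -> (x <= V)%MS ->
    z *: x = a *: (x *m J m) -> x = 0.
  move=> a0 ath xV /(congr1 (@sqnorm R N)); rewrite !sqnormZ => zx.
  apply/eqP; rewrite -sqnorm_eq0; apply: contraTT z_large => x0.
  have x_gt0 : 0 < sqnorm x by rewrite lt_def x0 sqnorm_ge0.
  rewrite -leNgt -(@ler_pXn2r _ 2)// ?nnegrE ?mulr_ge0// ?(ltW theta_gt0)//.
  rewrite real_normK ?num_real// -(ler_pM2r x_gt0) zx exprMn.
  rewrite -[leRHS]mulrA ler_pM ?sqr_ge0 ?sqnorm_ge0 ?Jle//.
  by rewrite lerXn2r ?nnegrE// ltW.
(* With y = u g, the vector y J' - z y is killed by z - theta J m. *)
have eig_g u : eig u -> eig (u *m g m).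
  move=> [uV uz]; have ugV : (u *m g m <= V)%MS.
    exact: submx_trans (submxMr _ uV) (gV _ (leqnn m)).
  split=> //.
  have ugz : z *: (u *m g m) - theta *: (u *m g m *m J m) = ((1 - theta) * z) *: u.
    have := congr1 (mulmx u) J'g.
    rewrite mulmxA uz -scalemxAl => ->; rewrite mulmxDr -!scalemxAr uz mulmxA.
    by rewrite addrK scalerA.
  apply/eqP; rewrite -subr_eq0; apply/eqP; apply: (inj theta) => //.
    rewrite addmx_sub ?eqmx_opp ?scalemx_sub//.
    exact: submx_trans (submxMr _ ugV) JV.
  set y := u *m g m in ugz ugV *.
  have A1 : z *: (y *m J') - theta *: (y *m J' *m J m) =
      ((1 - theta) * z * z) *: u.
    have := congr1 (mulmx^~ (J')) ugz.
    rewrite mulmxBl -!scalemxAl uz scalerA -(mulmxA y (J m)) J'J.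
    by rewrite (mulmxA y J').
  have A2 : z *: (z *: y) - theta *: (z *: y *m J m) =
      ((1 - theta) * z * z) *: u.
    have := congr1 (GRing.scale z) ugz; rewrite scalerBr !scalerA => zugz.
    by rewrite -scalemxAl scalerA [theta * z]mulrC zugz mulrC.
  rewrite scalerBr mulmxBl scalerBr; apply/eqP; rewrite -subr_eq0 opprD opprK.
  by rewrite addrACA A1 [- (z *: (z *: y)) + _]addrC -(opprB (z *: (z *: y))) A2 subrr.
have eigB u v : eig u -> eig v -> eig (u - v).
  move=> [uV uz] [vV vz]; split; first by rewrite addmx_sub ?eqmx_opp.
  by rewrite mulmxBl uz vz scalerBr.
(* w = u g - u satisfies w g = - theta w, and then theta^2 w (J m) = z w. *)
have top_fix u : eig u -> u *m g m = u.
  move=> eu; apply/eqP; rewrite -subr_eq0; apply/eqP.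
  have eg := eig_g _ eu; have [wV wz] := eigB _ _ eg eu.
  set w := _ - u in wV wz *.
  have wg : w *m g m = - theta *: w.
    rewrite mulmxBl -mulmxA gquad mulmxDr -scalemxAr mul_mx_scalar scalerBr.
    rewrite scalerBl scale1r !scaleNr opprK addrAC; congr (_ + _).
    by rewrite addrAC subrr add0r.
  apply: (inj (theta ^+ 2)) => //; first by rewrite exprn_gt0.
    by rewrite expr2 ler_piMl// ltW.
  have xg : theta *: (w *m J m *m g m) = - z *: w.
    by rewrite scaleNr -wz J'E !mulmxA wg scaleNr mulNmx mulNmx opprK -!scalemxAl.
  have := congr1 (mulmx^~ (g m)) xg.
  rewrite -!scalemxAl wg -mulmxA gquad mulmxDr -scalemxAr mul_mx_scalar scalerDr.
  rewrite scalerA mulrC -scalerA xg !scalerA expr2 => xw.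
  move/eqP: xw; rewrite addrC eq_sym -subr_eq -scalerBl => /eqP <-.
  by congr (_ *: _); rewrite mulrNN mulrN opprK mulrBl mul1r [theta * z]mulrC addrC subrK.
have eig_low i u : (i < m)%N -> eig u -> eig (u *m g i).
  move=> im [uV uz]; split.
    exact: submx_trans (submxMr _ uV) (gV _ (ltnW im)).
  by rewrite -mulmxA -(J'low _ im) mulmxA uz -scalemxAl.
(* If g (i+1) acts as 1 on the eigenspace, the braid relation gives g i g i = g i
   there, and g i is invertible. *)
have all_fix k i u : (i + k = m)%N -> eig u -> u *m g i = u.
  elim: k i u => [|k IHk] i u ikm eu.
    by rewrite -(addn0 i) ikm; apply: top_fix.
  have fixS w : eig w -> w *m g i.+1 = w by move=> ew; apply: IHk; rewrite ?addSnnS.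
  have im : (i < m)%N by rewrite -ikm addnS ltnS leq_addr.
  have eui : eig (u *m g i) by exact: eig_low.
  have := congr1 (mulmx u) (gbraid (_ : i.+1 < r)%N).
  rewrite !mulmxA fixS // (fixS _ eu) (fixS _ eui) -mulmxA gquad mulmxDr.
  rewrite -scalemxAr mul_mx_scalar => /(_ (leq_ltn_trans im mr)) /eqP.
  rewrite scalerBl scale1r -addrA -subr_eq0 [X in X == 0]addrC
    addKr addrC subr_eq0 => /eqP.
  by move/(scalerI (lt0r_neq0 theta_gt0)).
case/eqP: u0n0; apply: fix0 => // i im.
by apply: (all_fix (m - i)%N); [exact: subnKC | split].
Qed.

(** The eigenvalues of a generator are 1 and - theta. *)
Lemma gen_contract i (v : 'rV[R]_N) : sqnorm (v *m g i) <= sqnorm v.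
Proof.
rewrite -[leRHS]mul1r -[X in X * _](expr1n _ 2).
apply: (symmetric_norm_le (gsym i) (submx1 _)); last exact: submx1.
move=> z u _ uz u0; have : ((z - 1) * (z + theta)) *: u = 0.
  have := congr1 (mulmx u) (gquad i).
  rewrite mulmxA uz -scalemxAl uz mulmxDr -scalemxAr mul_mx_scalar uz !scalerA.
  rewrite -scalerDl => /eqP; rewrite -subr_eq0 -scalerBl => /eqP uE.
  by rewrite -[RHS]uE; congr (_ *: _); rewrite mulrDr !mulrBl !mul1r; ring.
move/eqP; rewrite scaler_eq0 (negbTE u0) orbF mulf_eq0 subr_eq0 addr_eq0.
by case/orP=> /eqP ->; rewrite ?normrN ?normr1// gtr0_norm.
Qed.

Lemma jucys_murphy_norm_le m (v : 'rV[R]_N) : sqnorm (v *m J m) <= sqnorm v.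
Proof.
elim: m v => [|m IHm] v /=; first by rewrite mulmx1.
rewrite !mulmxA; apply: le_trans (gen_contract _ _) _.
exact: le_trans (IHm _) (gen_contract _ _).
Qed.

Definition invariants j : 'M[R]_N :=
  (\bigcap_(i < j) kermx (g i - 1%:M))%MS.
Local Notation F := invariants.

Lemma invariantsP j p (v : 'M[R]_(p, N)) :
  reflect (forall i, (i < j)%N -> v *m g i = v) (v <= F j)%MS.
Proof.
apply: (iffP sub_bigcapmxP) => [vF i ij|vF i _].
  have /sub_kermxP/eqP := vF (Ordinal ij) isT.
  by rewrite mulmxBr mulmx1 subr_eq0 => /eqP.
by apply/sub_kermxP; rewrite mulmxBr mulmx1 vF// subrr.
Qed.

(** Without vectors invariant under the first j generators, J j is at most theta,
   and each of the m - j further conjugations gains another factor theta. *)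
Lemma jucys_murphy_decay p (V : 'M[R]_(p, N)) j m l :
  (j <= m <= r)%N -> (forall i, (i < r)%N -> stablemx V (g i)) ->
  (forall u : 'rV[R]_N, (u <= V)%MS -> (u <= F j)%MS -> u = 0) ->
  forall v : 'rV[R]_N, (v <= V)%MS ->
    sqnorm (iter l (mulmx^~ (J m)) v) <=
      (theta ^+ (m - j).+1) ^+ (2 * l) * sqnorm v.
Proof.
move=> /andP[jm mr] gV fix0.
have one v : (v <= V)%MS ->
    sqnorm (v *m J m) <= (theta ^+ (m - j).+1) ^+ 2 * sqnorm v.
  move: mr; rewrite -(subnKC jm) addKn; elim: (m - j)%N v => [|d IHd] v mr vV.
    rewrite addn0 in mr *; case: j fix0 {jm} mr => [|j] fix0 jr.
      by rewrite (fix0 v vV) ?mul0mx ?sqnorm0 ?mulr0//; apply/invariantsP.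
    rewrite expr1 -[theta]mulr1.
    apply: jucys_murphy_contract vV => // [i ij|u uV|u uV ufix].
    - by apply: gV; apply: leq_ltn_trans jr.
    - by rewrite expr1n mul1r jucys_murphy_norm_le.
    - by apply: fix0 => //; apply/invariantsP.
  rewrite addnS exprS; apply: (@jucys_murphy_contract _ V _ (theta ^+ d.+1)) vV.
  - by rewrite -addnS.
  - by rewrite exprn_ge0 ?ltW.
  - by move=> i ij; apply: gV; apply: leq_ltn_trans ij _; rewrite -addnS.
  - by move=> u uV; apply: IHd => //; apply: ltnW; rewrite -addnS.
  - move=> u uV ufix; apply: fix0 => //; apply/invariantsP => i ij.
    by apply: ufix; apply: leq_trans (ltnW ij) (leq_addr _ _).
elim: l => [|l IHl] v vV; first by rewrite muln0 expr0 mul1r.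
have JV : stablemx V (J m).
  by apply: jucys_murphy_stable => i im; apply: gV; apply: leq_trans mr.
have wV : (iter l (mulmx^~ (J m)) v <= V)%MS.
  by elim: l {IHl} => //= l IHl; apply: submx_trans (submxMr _ IHl) JV.
rewrite iterS mulnS exprD -mulrA; apply: le_trans (one _ wV) _.
by rewrite ler_wpM2l ?sqr_ge0 ?IHl.
Qed.

(** The product of the t generators g m, g (m-1), ..., in this order.  For
   t <= m+1 these represent the cosets, in the group of the generators up to m,
   of the subgroup of the generators below m. *)
Fixpoint coset_rep m t : 'M[R]_N :=
  if t is t'.+1 then coset_rep m t' *m g (m - t') else 1%:M.
Local Notation c := coset_rep.

Lemma coset_rep_comm M m t : (t <= m.+1)%N ->
  (forall i, (m < i + t)%N -> (i <= m)%N -> comm_mx (g i) M) -> comm_mx (c m t) M.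
Proof.
elim: t => [|t IHt] tm gM /=; first exact/comm_mx_sym/comm_mx1.
apply/comm_mx_sym/comm_mxM; apply/comm_mx_sym.
  by apply: IHt => [|i mi im]; [exact: ltnW | apply: gM; lia].
by apply: gM; lia.
Qed.

Lemma coset_rep_braid m t i : (m < r)%N -> (t <= m.+1)%N -> (i < m)%N ->
  (m < i + t)%N -> c m t *m g i.+1 = g i *m c m t.
Proof.
move=> mr; elim: t => [|t IHt] tm im mt; first lia.
have [mit|mit] : (m < i + t \/ m = i + t)%N by lia.
  rewrite /= -mulmxA (gfar (_ : (m - t).+1 < i.+1)%N); last lia.
  by rewrite mulmxA IHt ?mulmxA//; lia.
case: t => [|t] in IHt tm mt mit *; first lia.
have -> : c m t.+2 = c m t *m g i.+1 *m g i.
  by rewrite /=; congr (_ *m g _ *m g _); lia.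
transitivity (c m t *m (g i *m g i.+1 *m g i)).
  by rewrite gbraid ?mulmxA//; lia.
rewrite !mulmxA; congr (_ *m _ *m _); apply: coset_rep_comm => [|k mk km].
  lia.
by apply/comm_mx_sym/gfar; lia.
Qed.

(** The submodule over the first j + k generators spanned by the vectors
   invariant under the first j, as a sum of translates of these vectors by
   coset representatives. *)
Fixpoint generated j k : 'M[R]_N :=
  if k is k'.+1
  then (\sum_(t < (j + k').+2) generated j k' *m c (j + k') t)%MS else F j.
Local Notation W := generated.

(** A generator maps a coset representative to a neighbouring one or slides
   through it to become a generator of the smaller subgroup. *)
Lemma generated_stable j k i : (j + k <= r)%N -> (i < j + k)%N ->
  stablemx (W j k) (g i).
Proof.
elim: k i => [|k IHk] i jkr ijk /=.
  by rewrite addn0 in ijk; have /invariantsP -> := submx_refl (F j).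
rewrite addnS in jkr ijk; set m := (j + k)%N in jkr ijk IHk *.
rewrite sumsmxMr; apply/sumsmx_subP => /= t _.
have Wc s : (s <= m.+1)%N -> (W j k *m c m s <= \sum_(t < m.+2) W j k *m c m t)%MS.
  by move=> sm; apply: (sumsmx_sup (Ordinal (_ : s < m.+2)%N)).
have WgM b : (b < m)%N -> (W j k *m g b *m c m t <= W j k *m c m t)%MS.
  by move=> bm; rewrite submxMr// IHk// ltnW.
have tm : (t <= m.+1)%N by rewrite -ltnS.
have [it|[it|[it|it]]] : (i = m - t /\ t <= m \/ (i.+1 + t = m.+2 /\ 0 < t \/
    (i + t < m \/ m.+2 < i.+1 + t)))%N by lia.
- by case: it => -> ?; rewrite -mulmxA; apply: (Wc t.+1).
- case: t {WgM} it tm => -[|t] /= tlt [it t0] tm //.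
  rewrite (_ : m - t = i)%N; last lia.
  rewrite -!mulmxA gquad !mulmxDr -!scalemxAr mul_mx_scalar -scalemxAr.
  rewrite addmx_sub ?scalemx_sub ?Wc//; last exact: ltnW.
  have := Wc t.+1 tm; rewrite /= (_ : m - t = i)%N//; lia.
- rewrite -mulmxA; have -> : c m t *m g i = g i *m c m t.
    by apply: coset_rep_comm => // b mb bm; apply/comm_mx_sym/gfar; lia.
  by rewrite mulmxA; apply: submx_trans (Wc t tm); apply: WgM; lia.
- case: i it ijk => [|i] it ijk; first lia.
  have br : c m t *m g i.+1 = g i *m c m t by apply: coset_rep_braid; lia.
  by rewrite -mulmxA br mulmxA; apply: submx_trans (Wc t tm); apply: WgM; lia.
Qed.

Lemma generated_min j k p (U : 'M[R]_(p, N)) :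
  (forall i, (i < j + k)%N -> stablemx U (g i)) -> (F j <= U)%MS ->
  (W j k <= U)%MS.
Proof.
elim: k => [|k IHk] //= gU FU; apply/sumsmx_subP => t _.
have WU : (W j k <= U)%MS by apply: IHk => // i ijk; apply: gU; lia.
apply: submx_trans (submxMr _ WU) _; elim: (t : nat) (ltn_ord t) => [|s IHs] sm /=.
  by rewrite mulmx1.
rewrite mulmxA; apply: submx_trans (submxMr _ (IHs (ltnW sm))) _.
by apply: gU; lia.
Qed.

Lemma generated_inv j k : (F j <= W j k)%MS.
Proof.
elim: k => //= k IHk; apply: (sumsmx_sup ord0) => //.
by rewrite mulmx1.
Qed.

Fixpoint coset_reps j k : seq 'M[R]_N :=
  if k is k'.+1
  then [seq d *m c (j + k') t | d <- coset_reps j k', t <- iota 0 (j + k').+2]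
  else [:: 1%:M].

Lemma size_coset_reps j k : (j + k <= r)%N -> (size (coset_reps j k) <= r.+1 ^ k)%N.
Proof.
elim: k => [//|k IHk] jkr; rewrite size_allpairs size_iota expnSr.
by rewrite leq_mul ?IHk//; lia.
Qed.

Lemma generated_orth j k (v : 'rV[R]_N) :
  {in coset_reps j k, forall d, v *m d^T *m (F j)^T = 0} -> v *m (W j k)^T = 0.
Proof.
elim: k v => [|k IHk] v vd /=.
  by have := vd 1%:M (mem_head _ _); rewrite trmx1 mulmx1.
have [u ->] := sub_sumsmxP (submx_refl (\sum_(t < (j + k).+2) W j k *m c (j + k) t)%MS).
rewrite linear_sum mulmx_sumr big1 //= => t _; rewrite !trmx_mul !mulmxA IHk ?mul0mx//.
move=> d dD; rewrite -(mulmxA v) -trmx_mul vd//.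
by apply/allpairsP; exists (d, t : nat); rewrite mem_iota /=.
Qed.

(** From here on the generators belong to the commutant of a family S of symmetric
   matrices on which the coefficient at o is a trace. *)
Variables (I : Type) (S : I -> 'M[R]_N) (o : 'I_N).
Hypothesis Ssym : forall i, (S i)^T = S i.
Hypothesis gS : forall k, commutant S (g k).
Hypothesis traceC : forall a b,
  commutant S a -> commutant S b -> (a *m b) o o = (b *m a) o o.

Local Notation e j := (orthproj (F j)).
Local Notation P j := (orthproj (W j (r - j))).

Lemma invariants_commutant j : commutant S (e j).
Proof.
apply: commutant_orthproj => // i; apply/invariantsP => k kj.
by rewrite -mulmxA -gS mulmxA; have /invariantsP -> := submx_refl (F j).
Qed.

Lemma coset_rep_commutant m t : commutant S (c m t).
Proof.
by elim: t => [|t IHt]; [exact: commutant1 | apply: commutantM].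
Qed.

Lemma generated_commutant j k : commutant S (orthproj (W j k)).
Proof.
apply: commutant_orthproj => // i.
elim: k => [|k IHk] /=.
  apply/invariantsP => k kj.
  by rewrite -mulmxA -gS mulmxA; have /invariantsP -> := submx_refl (F j).
rewrite sumsmxMr; apply/sumsmx_subP => t _; apply: (sumsmx_sup t) => //.
by rewrite -mulmxA coset_rep_commutant mulmxA submxMr.
Qed.

Lemma coset_reps_commutant j k : {in coset_reps j k, forall d, commutant S d}.
Proof.
elim: k => [|k IHk] d; first by rewrite inE => /eqP ->; exact: commutant1.
case/allpairsP => -[a t] /= [/IHk Ca _ ->].
exact/commutantM/coset_rep_commutant.
Qed.

(** The generated submodule embeds into as many copies of the invariant vectors as
   there are coset representatives. *)
Lemma generated_trace_le j : (j <= r)%N ->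
  P j o o <= (r.+1 ^ (r - j))%:R * e j o o.
Proof.
move=> jr; have := @trace_le_size _ _ _ _ Ssym o traceC
  (map trmx (coset_reps j (r - j))) (e j) (P j) (orthprojP _)
  (invariants_commutant j) (orthprojP _) (generated_commutant _ _).
move=> /(_ _ _)/le_trans; apply.
- by move=> _ /mapP[d dD ->]; exact/commutant_tr/coset_reps_commutant/dD.
- move=> v vP vd; rewrite -vP; apply/orthproj_eq0/generated_orth => d dD.
  have /(congr1 (mulmx^~ (F j)^T)) := vd _ (map_f trmx dD).
  rewrite mul0mx -mulmxA => <-; congr (_ *m _).
  by rewrite -[e j]trmx_orthproj -trmx_mul orthproj_id.
rewrite size_map ler_wpM2r ?ler_nat ?size_coset_reps ?subnKC//.
exact/orthproj_trace_ge0/orthprojP.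
Qed.

Lemma generated_leS j : (j < r)%N -> (W j.+1 (r - j.+1) <= W j (r - j))%MS.
Proof.
move=> jr; apply: generated_min => [i|].
  rewrite subnKC// => ir.
  by apply: generated_stable; rewrite subnKC// ltnW.
apply: submx_trans (generated_inv j _); apply/invariantsP => i ij.
by have /invariantsP -> := submx_refl (F j.+1); last exact: ltnW.
Qed.

Lemma sqnorm_delta_orthproj (p : 'M[R]_N) : is_orthproj p ->
  sqnorm (delta_mx 0 o *m p) = p o o.
Proof. by move=> pP; rewrite (orthproj_trace o pP) rowE. Qed.

(** The submodules generated by the invariants of the first r, r - 1, ..., 0
   generators increase up to the whole space, and on the k-th successive
   orthogonal difference J r is at most theta^k. *)
Lemma hecke_return_le l :
  sqnorm (iter l (mulmx^~ (J r)) (delta_mx 0 o : 'rV[R]_N)) <=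
  \sum_(k < r.+1) theta ^+ (2 * l * k) * ((r.+1 ^ k)%:R * e (r - k) o o).
Proof.
set d : 'rV[R]_N := delta_mx 0 o; pose M := iter l (mulmx^~ (J r)) 1%:M.
have iterM (v : 'rV[R]_N) : iter l (mulmx^~ (J r)) v = v *m M.
  by rewrite /M; elim: (l) => [|l' IHl]; rewrite ?mulmx1// !iterS IHl mulmxA.
have Pg j i : (j <= r)%N -> (i < r)%N -> comm_mx (P j) (g i).
  move=> jr ir; apply: orthproj_comm (gsym i) _.
  by apply: generated_stable; rewrite subnKC.
have PM j : (j <= r)%N -> comm_mx (P j) M.
  move=> jr; have PJ : comm_mx (P j) (J r).
    by apply/comm_mx_sym/jucys_murphy_comm => i ir; apply/comm_mx_sym/Pg.
  rewrite /M; elim: (l) => [|l' IHl]; first exact: comm_mx1.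
  by rewrite iterS; apply: comm_mxM.
suff bound k : (k <= r)%N -> sqnorm (d *m P (r - k) *m M) <=
    \sum_(i < k.+1) theta ^+ (2 * l * i) * P (r - i) o o.
  have P1 : P 0 = 1%:M.
    have : (1%:M <= W 0 (r - 0))%MS.
      by apply: submx_trans (generated_inv _ _); apply/invariantsP.
    by move=> /orthproj_id; rewrite mul1mx.
  have := bound r (leqnn r); rewrite subnn P1 mulmx1 -iterM => /le_trans; apply.
  apply: ler_sum => i _; rewrite ler_wpM2l ?exprn_ge0 ?(ltW theta_gt0)//.
  apply: le_trans (generated_trace_le (leq_subr i r)) _.
  by rewrite subKn// -ltnS.
elim: k => [|k IHk] kr.
  rewrite big_ord1 muln0 expr0 mul1r subn0 -sqnorm_delta_orthproj; last exact: orthprojP.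
  rewrite -iterM; elim: (l) => //= l' IHl.
  exact: le_trans (jucys_murphy_norm_le _ _) IHl.
have rk : (r - k = (r - k.+1).+1)%N by rewrite subnSK.
set p := P (r - k) in IHk *; set p' := P (r - k.+1).
have pP : is_orthproj p by exact: orthprojP.
have p'P : is_orthproj p' by exact: orthprojP.
have pp' : p *m p' = p.
  apply: orthproj_id; apply: submx_trans (orthproj_sub _) _.
  by have := @generated_leS (r - k.+1); rewrite -rk leq_subr; apply.
have qP : is_orthproj (p' - p) by apply: orthprojB.
have pq : p *m (p' - p) = 0 by rewrite mulmxBr pp' pP.2 subrr.
have qM : comm_mx (p' - p) M.
  by apply/comm_mx_sym/comm_mxB; apply/comm_mx_sym/PM; rewrite leq_subr.
have qMT : comm_mx (p' - p) M^T.
  by rewrite /comm_mx -[in LHS]qP.1 -trmx_mul -qM trmx_mul qP.1.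
rewrite -(subrK p p') addrC mulmxDr mulmxDl sqnormD_orth; last first.
  rewrite !trmx_mul qP.1 -!mulmxA (mulmxA M^T) -qMT !mulmxA -(mulmxA _ M).
  by rewrite -qM !mulmxA -(mulmxA d p) pq mulmx0 !mul0mx.
rewrite big_ord_recr lerD ?IHk ?(ltnW kr)//=.
have := @jucys_murphy_decay _ (1%:M - p) (r - k) r l _ _ _ (d *m (p' - p)) _.
rewrite iterM subKn ?(ltnW kr)// => decay.
apply: le_trans (decay _ _ _ _) _.
- by rewrite leq_subr leqnn.
- move=> i ir; rewrite mulmxBl mul1mx Pg ?leq_subr//.
  by rewrite -[X in X - _]mulmx1 -mulmxBr submxMl.
- move=> u /submxP[w ->] uF.
  have : (w *m (1%:M - p) <= W (r - k) (r - (r - k)))%MS.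
    exact: submx_trans (generated_inv _ _).
  move=> /orthproj_id <-; rewrite -mulmxA mulmxBl mul1mx.
  by rewrite (orthproj_idem (W (r - k) _)) subrr mulmx0.
- have qp : (p' - p) *m p = 0 by rewrite -[LHS]trmxK trmx_mul pP.1 qP.1 pq trmx0.
  apply/submxP; exists (d *m (p' - p)).
  by rewrite [RHS]mulmxBr mulmx1 -(mulmxA d _ p) qp mulmx0 subr0.
rewrite -exprM mulnC; apply: ler_wpM2l; first by rewrite exprn_ge0 ?ltW.
rewrite sqnorm_delta_orthproj// !mxE lerBlDr lerDl.
exact: orthproj_trace_ge0.
Qed.

End HeckeOperators.

(** * Length, inversions and descents of permutations *)

Section Length.
Variable n : nat.
Implicit Types (w u v : 'S_n) (i j : 'I_n.-1) (x y : 'I_n).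

Definition lo i : 'I_n := Ordinal (ltnW (gen_ltn i)).
Definition hi i : 'I_n := Ordinal (gen_ltn i).
Local Notation s i := (simple_tperm i).
Local Notation len := (@perm_length n).

(** Permutations compose from left to right, so s i * w is w with the letters in
   positions i and i + 1 exchanged. *)
Definition ascent w i := (w (lo i) < w (hi i))%N.

Lemma lo_hi_neq i : lo i != hi i.
Proof. by rewrite -val_eqE /= ltn_eqF. Qed.

Lemma simple_tpermK i : (s i * s i = 1)%g.
Proof. exact: tperm2. Qed.

Lemma mul_simple_tpermK i w : (s i * (s i * w) = w)%g.
Proof. by rewrite mulgA simple_tpermK mul1g. Qed.

Lemma simple_tperm_lo i : s i (lo i) = hi i.
Proof. exact: tpermL. Qed.

Lemma simple_tperm_hi i : s i (hi i) = lo i.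
Proof. exact: tpermR. Qed.

Lemma simple_tperm_out i x : x != i :> nat -> x != i.+1 :> nat -> s i x = x.
Proof. by move=> xi xi1; rewrite tpermD// -val_eqE /= eq_sym. Qed.

(** An adjacent exchange reverses the order of a single pair of positions. *)
Lemma simple_tperm_mono i x y :
  (x < y)%N -> (x, y) != (lo i, hi i) -> (s i x < s i y)%N.
Proof.
rewrite xpair_eqE -!val_eqE /= /simple_tperm => xy xyi.
case: tpermP => [xE|xE|/eqP + /eqP]; case: tpermP => [yE|yE|/eqP + /eqP];
  rewrite -?val_eqE ?xE ?yE /= in xy xyi *; move: xyi; rewrite ?eqxx; lia.
Qed.

Definition inversions w : {set 'I_n * 'I_n} :=
  [set p : 'I_n * 'I_n | (p.1 < p.2)%N && (w p.2 < w p.1)%N].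

Lemma card_inversions_ascent w i :
  ascent w i -> #|inversions (s i * w)%g| = #|inversions w|.+1.
Proof.
move=> asc; pose f (p : 'I_n * 'I_n) := (s i p.1, s i p.2).
have fK : involutive f by case=> x y; rewrite /f /= -!permM simple_tpermK !perm1.
have -> : inversions (s i * w)%g = (lo i, hi i) |: f @: inversions w.
  apply/setP => -[x y]; rewrite !inE /= !permM.
  have [[-> ->]|xyi] /= := eqVneq (x, y) (lo i, hi i).
    by rewrite simple_tperm_lo simple_tperm_hi; apply/andP.
  rewrite -[in RHS](fK (x, y)) (mem_imset _ _ (can_inj fK)) inE /=.
  apply/andP/andP => -[xy wxy]; split=> //; first exact: simple_tperm_mono.
  have := @simple_tperm_mono i _ _ xy; rewrite -!permM simple_tpermK !perm1.
  apply; apply: contraTneq wxy => -[-> ->].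
  by rewrite -leqNgt; apply: ltnW.
rewrite cardsU1 card_imset ?add1n; last exact: can_inj fK.
case: imsetP => //= -[[x y]]; rewrite inE /= => /andP[xy _] [lE hE].
have := congr1 (s i) lE; have := congr1 (s i) hE.
rewrite simple_tperm_lo simple_tperm_hi -!permM simple_tpermK !perm1 => yE xE.
by move: xy; rewrite -yE -xE /=; lia.
Qed.

Lemma ascentN w i : ascent (s i * w)%g i = ~~ ascent w i.
Proof.
rewrite /ascent !permM simple_tperm_lo simple_tperm_hi -leqNgt ltn_neqAle.
rewrite andb_idl// => _.
by rewrite (inj_eq val_inj) (inj_eq perm_inj) eq_sym lo_hi_neq.
Qed.

Lemma card_inversions_descent w i :
  ~~ ascent w i -> #|inversions w| = #|inversions (s i * w)%g|.+1.
Proof.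
by move=> des; rewrite -{1}(mul_simple_tpermK i w) card_inversions_ascent// ascentN.
Qed.

Lemma inversions1 : inversions 1%g = finset.set0.
Proof. by apply/setP => -[x y]; rewrite !inE !perm1 /=; lia. Qed.

Lemma ascent_all_1 w : (forall i, ascent w i) -> w = 1%g.
Proof.
move=> asc; have step x y : y = x.+1 :> nat -> (w x < w y)%N.
  move=> yE; have xn : (x < n.-1)%N by have := ltn_ord y; lia.
  have := asc (Ordinal xn); rewrite /ascent.
  have -> : lo (Ordinal xn) = x by apply/val_inj.
  by have -> : hi (Ordinal xn) = y by apply/val_inj; rewrite /= yE.
apply/permP => x; rewrite perm1; apply/val_inj/eqP; rewrite /= eqn_leq; apply/andP.
split.
  have [d] := ubnP (n - x); elim: d x => // d IHd x xd.
  have [xn|xn] := ltnP x.+1 n.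
    have : (w (Ordinal xn) <= x.+1)%N by apply: (IHd (Ordinal xn)) => /=; lia.
    by have := @step x (Ordinal xn) erefl; lia.
  by have := ltn_ord (w x); lia.
case: x; elim=> // k IHk kn; have kn' := ltnW kn.
exact: leq_ltn_trans (IHk kn') (step (Ordinal kn') (Ordinal kn) erefl).
Qed.

Local Notation word t := (\prod_(i <- t) s i)%g.

Lemma is_wordP w k :
  reflect (exists2 t : seq 'I_n.-1, size t = k & w = word t) (is_word w k).
Proof.
apply: (iffP existsP) => [[t /eqP ->]|[t tk ->]].
  by exists t => //; rewrite size_tuple.
by move/eqP: tk => tk; exists (Tuple tk).
Qed.

Lemma perm_length_word t : (len (word t) <= size t)%N.
Proof.
by rewrite /perm_length; case: ex_minnP => k _; apply; apply/is_wordP; exists t.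
Qed.

Lemma perm_lengthP w : exists2 t, size t = len w & w = word t.
Proof. by rewrite /perm_length; case: ex_minnP => k /is_wordP. Qed.

(** A permutation other than 1 has a descent, and removing it removes exactly one
   inversion. *)
Lemma perm_length_inversions w : len w = #|inversions w|.
Proof.
apply/eqP; rewrite eqn_leq; apply/andP; split.
  suff [t <- ->] : exists2 t, size t = #|inversions w| & w = word t.
    exact: perm_length_word.
  have [d] := ubnP #|inversions w|; elim: d w => // d IHd w wd.
  have [/forallP asc|] := boolP [forall i, ascent w i].
    exists [::]; last by rewrite big_nil (ascent_all_1 asc).
    by rewrite (ascent_all_1 asc) inversions1 cards0.
  rewrite negb_forall => /existsP[i des].
  have wE := card_inversions_descent des.
  have [|t tE wt] := IHd (s i * w)%g; first by move: wd; rewrite wE ltnS.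
  by exists (i :: t); rewrite /= ?tE ?wE// big_cons -wt mul_simple_tpermK.
have [t <- ->] := perm_lengthP w; elim: t {w} => [|i t IHt].
  by rewrite big_nil inversions1 cards0.
rewrite big_cons /=; case: (boolP (ascent (word t) i)) => asc.
  by rewrite card_inversions_ascent.
by apply: leq_trans (leqW IHt); rewrite (card_inversions_descent asc).
Qed.

Lemma perm_length_ascent w i : ascent w i -> len (s i * w)%g = (len w).+1.
Proof. by rewrite !perm_length_inversions; apply: card_inversions_ascent. Qed.

Lemma perm_length_descent w i : ~~ ascent w i -> len w = (len (s i * w)%g).+1.
Proof. by rewrite !perm_length_inversions; apply: card_inversions_descent. Qed.

Lemma ascent_length w i : (len w < len (s i * w)%g)%N = ascent w i.
Proof.
case: (boolP (ascent w i)) => asc; first by rewrite perm_length_ascent ?ltnSn.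
by rewrite (perm_length_descent asc) ltnNge leqnSn.
Qed.

Lemma perm_lengthV w : len w^-1%g = len w.
Proof.
suff le u : (len u^-1%g <= len u)%N by apply/eqP; rewrite eqn_leq le -{1}(invgK w) le.
have [t <- ->] := perm_lengthP u.
suff -> : ((word t)^-1 = word (rev t))%g by rewrite -(size_rev t) perm_length_word.
elim: t => [|i t IHt]; first by rewrite !big_nil invg1.
by rewrite rev_cons -cats1 big_cat big_seq1 big_cons invMg IHt tpermV.
Qed.

Lemma perm_lengthM u v : (len (u * v)%g <= len u + len v)%N.
Proof.
have [t <- ->] := perm_lengthP u; have [t' <- ->] := perm_lengthP v.
by rewrite -big_cat -size_cat perm_length_word.
Qed.

Lemma perm_length1 : len 1%g = 0%N.
Proof. by rewrite perm_length_inversions inversions1 cards0. Qed.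

Lemma perm_length_descent_ex w :
  w != 1%g -> exists i, ~~ ascent w i.
Proof.
move=> w1; apply/existsP; rewrite -negb_forall.
by apply: contraNN w1 => /forallP/ascent_all_1/eqP.
Qed.

(** Exchanging two adjacent positions and two adjacent letters interact only
   when they are the same exchange. *)
Lemma ascentV_mul w i j : (s i * w)%g != (w * s j)%g ->
  ascent (s i * w)^-1%g j = ascent w^-1%g j.
Proof.
move=> ne; rewrite /ascent invMg tpermV !permM.
have ne1 : (w^-1%g (lo j), w^-1%g (hi j)) != (lo i, hi i).
  apply: contraNneq ne => -[lE hE]; apply/eqP.
  by rewrite conjgC tpermJ -/(lo i) -/(hi i) -lE -hE !permKV.
have ne2 : (w^-1%g (hi j), w^-1%g (lo j)) != (lo i, hi i).
  apply: contraNneq ne => -[lE hE]; apply/eqP.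
  by rewrite conjgC tpermJ -/(lo i) -/(hi i) -lE -hE !permKV tpermC.
have [lt|gt|/val_inj/perm_inj eq] := ltngtP (w^-1%g (lo j)) (w^-1%g (hi j)).
- exact: simple_tperm_mono.
- by apply/negbTE; rewrite -leqNgt ltnW// simple_tperm_mono.
- by have := lo_hi_neq j; rewrite eq eqxx.
Qed.

End Length.

(** * The two commuting Hecke actions on functions on the symmetric group *)

HB.lock Definition basis (R : rcfType) n (w : 'S_n) : 'rV[R]_#|{: 'S_n}| :=
  delta_mx 0 (enum_rank w).

(** Holding probability of a step, according to whether it meets an ascent. *)
Definition stay (R : rcfType) (theta : R) (b : bool) : R :=
  if b then 0 else 1 - theta.

(** The Metropolis step conjugated by the square root of the stationary
   distribution, which makes it symmetric; sigma stands for the square root of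
   theta. *)
HB.lock Definition left_step (R : rcfType) (theta sigma : R) n (i : 'I_n.-1) :
    'M[R]_#|{: 'S_n}| :=
  \matrix_(a < #|{: 'S_n}|)
    (sigma *: basis R (simple_tperm i * enum_val a)%g
     + stay theta (ascent (enum_val a) i) *: basis R (enum_val a)).

(** The same step for right multiplication, that is, on letters instead of
   positions.  These matrices serve to cut out an algebra of matrices, their
   commutant, which contains all the left steps. *)
HB.lock Definition right_step (R : rcfType) (theta sigma : R) n (j : 'I_n.-1) :
    'M[R]_#|{: 'S_n}| :=
  \matrix_(a < #|{: 'S_n}|)
    (sigma *: basis R (enum_val a * simple_tperm j)%g
     + stay theta (ascent (enum_val a)^-1%g j) *: basis R (enum_val a)).

Section StepOperators.
Variables (R : rcfType) (theta sigma : R) (n : nat).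
Implicit Types (w u v : 'S_n) (i j k : 'I_n.-1).
Local Notation N := #|{: 'S_n}|.
Local Notation s i := (simple_tperm i).
Local Notation len := (@perm_length n).

Local Notation ev := (@basis R n).
Local Notation stay := (stay theta).
Local Notation left_step := (@left_step R theta sigma n).
Local Notation right_step := (@right_step R theta sigma n).

Lemma basisE w u : ev w 0 (enum_rank u) = (u == w)%:R.
Proof. by rewrite basis.unlock mxE eqxx (inj_eq enum_rank_inj). Qed.

Lemma basis_mx_inj (A B : 'M[R]_N) : (forall w, ev w *m A = ev w *m B) -> A = B.
Proof.
move=> AB; apply/row_matrixP => a; rewrite -(enum_valK a) !rowE.
by have := AB (enum_val a); rewrite basis.unlock.
Qed.

Lemma basis_entry (A : 'M[R]_N) w u :
  (ev w *m A *m (ev u)^T) 0 0 = A (enum_rank w) (enum_rank u).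
Proof. by rewrite basis.unlock -rowE trmx_delta -colE !mxE. Qed.

Lemma left_stepE w i :
  ev w *m left_step i = sigma *: ev (s i * w)%g + stay (ascent w i) *: ev w.
Proof. by rewrite left_step.unlock {1}basis.unlock -rowE rowK enum_rankK. Qed.

Lemma right_stepE w j :
  ev w *m right_step j =
    sigma *: ev (w * s j)%g + stay (ascent w^-1%g j) *: ev w.
Proof. by rewrite right_step.unlock {1}basis.unlock -rowE rowK enum_rankK. Qed.

Lemma left_step_sym i : (left_step i)^T = left_step i.
Proof.
apply/matrixP => a b; rewrite -(enum_valK a) -(enum_valK b).
move: (enum_val a) (enum_val b) => u v; rewrite left_step.unlock !mxE !enum_rankK !basisE.
have -> : (u == (s i * v)%g) = (v == (s i * u)%g).
  by apply/eqP/eqP => ->; rewrite mul_simple_tpermK.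
by rewrite [u == v]eq_sym; have [->|_] := eqVneq v u; rewrite ?mulr0.
Qed.

Lemma right_step_sym j : (right_step j)^T = right_step j.
Proof.
apply/matrixP => a b; rewrite -(enum_valK a) -(enum_valK b).
move: (enum_val a) (enum_val b) => u v; rewrite right_step.unlock !mxE !enum_rankK !basisE.
have -> : (u == (v * s j)%g) = (v == (u * s j)%g).
  by apply/eqP/eqP => ->; rewrite -mulgA simple_tpermK mulg1.
by rewrite [u == v]eq_sym; have [->|_] := eqVneq v u; rewrite ?mulr0.
Qed.

Lemma right_ascent_length w j : (len w < len (w * s j)%g)%N = ascent w^-1%g j.
Proof.
rewrite -ascent_length perm_lengthV -[(s j * _)%g]invgK perm_lengthV.
by rewrite invMg invgK tpermV.
Qed.

Lemma left_right_comm i j : comm_mx (left_step i) (right_step j).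
Proof.
apply: basis_mx_inj => w; rewrite !mulmxA left_stepE right_stepE.
rewrite !mulmxDl -!scalemxAl !left_stepE !right_stepE !mulgA.
have [E|ne] := eqVneq (s i * w)%g (w * s j)%g.
  have ij : ascent w^-1%g j = ascent w i.
    by rewrite -right_ascent_length -ascent_length E.
  have ji : ascent (w * s j)^-1%g j = ~~ ascent w^-1%g j.
    by rewrite invMg tpermV ascentN.
  rewrite E ji -E ascentN ij.
  by case: ascent; apply/rowP => a; rewrite !mxE /stay /=; ring.
have ji : ascent (w * s j)%g i = ascent w i.
  have := @ascentV_mul _ w^-1%g j i; rewrite invMg !invgK tpermV; apply.
  by rewrite -(inj_eq invg_inj) !invMg !tpermV invgK eq_sym.
by rewrite ascentV_mul// ji; apply/rowP => a; rewrite !mxE; ring.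
Qed.

Lemma left_step_far i k : (i.+1 < k)%N -> comm_mx (left_step i) (left_step k).
Proof.
move=> ik; apply: basis_mx_inj => w; rewrite !mulmxA !left_stepE.
have sik : (s i * s k = s k * s i)%g.
  rewrite [LHS]conjgC; congr (_ * _)%g.
  by rewrite tpermJ /simple_tperm !tpermD// -val_eqE /=; lia.
have aki : ascent (s i * w)%g k = ascent w k.
  by rewrite /ascent !permM !(@simple_tperm_out _ i)//=; lia.
have aik : ascent (s k * w)%g i = ascent w i.
  by rewrite /ascent !permM !(@simple_tperm_out _ k)//=; lia.
rewrite !mulmxDl -!scalemxAl !left_stepE !mulgA sik aki aik.
by apply/rowP => a; rewrite !mxE; ring.
Qed.

Lemma left_step_quad i : sigma ^+ 2 = theta ->
  left_step i *m left_step i = (1 - theta) *: left_step i + theta%:M.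
Proof.
move=> sigma2; apply: basis_mx_inj => w.
rewrite mulmxA left_stepE mulmxDl -!scalemxAl !left_stepE mul_simple_tpermK ascentN.
rewrite mulmxDr -scalemxAr left_stepE mul_mx_scalar -sigma2.
by case: ascent; rewrite /stay /= -?sigma2; apply/rowP => a; rewrite !mxE; ring.
Qed.

Local Notation commR := (commutant right_step).

Lemma left_step_commutant i : commR (left_step i).
Proof. by move=> j; exact: left_right_comm. Qed.

Lemma right_descent_ex w : w != 1%g ->
  exists j, (~~ ascent w^-1%g j) && (len w == (len (w * s j)%g).+1).
Proof.
move=> w1; have [|j des] := @perm_length_descent_ex _ w^-1%g.
  by rewrite invg_eq1.
exists j; rewrite des -[X in X == _]perm_lengthV (perm_length_descent des).
by rewrite -[(s j * _)%g]invgK perm_lengthV invMg invgK tpermV eqxx.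
Qed.

Hypothesis sigma_gt0 : 0 < sigma.

(** The vector of 1 is cyclic for the right steps. *)
Lemma commutant_inj A B : commR A -> commR B -> ev 1%g *m A = ev 1%g *m B -> A = B.
Proof.
move=> CA CB AB; apply: basis_mx_inj => w.
have [d] := ubnP (len w); elim: d w => // d IHd w.
have [->//|w1] := eqVneq w 1%g.
have [j /andP[des /eqP ->]] := right_descent_ex w1; rewrite ltnS => lwd.
have asc : ascent (w * s j)^-1%g j by rewrite invMg tpermV ascentN.
have E : ev w = sigma^-1 *: (ev (w * s j)%g *m right_step j).
  rewrite right_stepE asc scale0r addr0 scalerA mulVf ?lt0r_neq0// scale1r.
  by rewrite -mulgA simple_tpermK mulg1.
by rewrite E -!scalemxAl -!mulmxA -CA -CB !mulmxA IHd.
Qed.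

(** Moving a reduced word of w across a matrix of the commutant, one letter at a
   time; no step meets a descent as long as lengths add up. *)
Lemma commutant_shift A w u : commR A -> len (u * w^-1)%g = (len u + len w)%N ->
  A (enum_rank w) (enum_rank u) = A (enum_rank 1%g) (enum_rank (u * w^-1)%g).
Proof.
move=> CA; have [d] := ubnP (len w); elim: d w u => // d IHd w u.
have [->|w1] := eqVneq w 1%g; first by rewrite invg1 mulg1.
have [j /andP[des /eqP lw]] := right_descent_ex w1; rewrite lw ltnS => lwd luw.
set w' := (w * s j)%g in lwd lw luw.
have wE : w = (w' * s j)%g by rewrite /w' -mulgA simple_tpermK mulg1.
have uwE : (u * w^-1 = u * s j * w'^-1)%g by rewrite wE invMg tpermV mulgA.
have asc : ascent w'^-1%g j by rewrite /w' invMg tpermV ascentN.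
have luj : len (u * s j)%g = (len u).+1.
  have := perm_lengthM (u * s j)%g w'^-1%g; rewrite -uwE luw perm_lengthV addnS -addSn.
  rewrite leq_add2r => le; apply/eqP; rewrite eqn_leq le andbT.
  apply: leq_trans (perm_lengthM _ _) _; rewrite -addn1 leq_add2l.
  by have := perm_length_word [:: j]; rewrite big_seq1.
have ascu : ascent u^-1%g j by rewrite -right_ascent_length luj.
have <- : A (enum_rank w') (enum_rank (u * s j)%g) = A (enum_rank w) (enum_rank u).
  rewrite -!basis_entry; apply: (mulfI (lt0r_neq0 sigma_gt0)).
  have := congr1 (fun M => (ev w' *m M *m (ev u)^T) 0 0) (CA j).
  rewrite /= !mulmxA right_stepE asc scale0r addr0 -wE.
  rewrite -(mulmxA _ (right_step j)) -{1}right_step_sym -trmx_mul right_stepE ascu.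
  by rewrite scale0r addr0 linearZ /= -scalemxAr -!scalemxAl !mxE.
by rewrite uwE IHd// -uwE luw luj addnS addSn.
Qed.

Lemma commutant_antisym A w : commR A ->
  A (enum_rank w) (enum_rank 1%g) = A (enum_rank 1%g) (enum_rank w^-1%g).
Proof.
by move=> CA; rewrite commutant_shift// ?mul1g// perm_lengthV perm_length1.
Qed.

(** By commutant_antisym both sides are the sum of A(1,w) B(1,w^-1) over w. *)
Lemma commutant_traceC A B : commR A -> commR B ->
  (A *m B) (enum_rank 1%g) (enum_rank 1%g) = (B *m A) (enum_rank 1%g) (enum_rank 1%g).
Proof.
move=> CA CB; rewrite !mxE.
rewrite (reindex_onto enum_rank enum_val) /=; last by move=> a _; rewrite enum_valK.
rewrite [RHS](reindex_onto enum_rank enum_val) /=; last by move=> a _; rewrite enum_valK.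
rewrite [RHS](reindex_inj invg_inj) /=; apply: eq_big => w; rewrite !enum_rankK ?eqxx// => _.
by rewrite !commutant_antisym// mulrC invgK.
Qed.

End StepOperators.

(** * The generators of the Hecke algebra and their braid relations *)

Section HeckeRelations.
Variables (R : rcfType) (theta sigma : R) (n : nat).
Implicit Types (w u v : 'S_n) (i j k : 'I_n.-1).
Local Notation N := #|{: 'S_n}|.
Local Notation s i := (simple_tperm i).
Local Notation len := (@perm_length n).
Local Notation ev := (@basis R n).
Local Notation L := (@left_step R theta sigma n).

Lemma simple_tperm_neighbours i k : k = i.+1 :> nat ->
  [/\ s i (hi k) = hi k, s k (lo i) = lo i & lo k = hi i].
Proof.
move=> ki; split; last by apply/val_inj.
  by apply: simple_tperm_out => /=; lia.
by apply: simple_tperm_out => /=; lia.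
Qed.

Lemma simple_tperm_braid i k : k = i.+1 :> nat ->
  (s i * (s k * s i) = s k * (s i * s k))%g.
Proof.
move=> ki; have [sh sl lk] := simple_tperm_neighbours ki.
have conj a b : (s a * (s b * s a) = tperm (s a (lo b)) (s a (hi b)))%g.
  by rewrite -tpermJ /conjg {2}/simple_tperm tpermV -/(simple_tperm a) mulgA.
by rewrite !conj sh sl lk simple_tperm_hi -lk simple_tperm_lo.
Qed.

(** Starting from 1 the three steps only meet ascents. *)
Lemma left_step_walk (a b : 'I_n.-1) : a = b.+1 :> nat \/ b = a.+1 :> nat ->
  ev 1%g *m (L a *m L b *m L a) = sigma ^+ 3 *: ev (s a * (s b * s a))%g.
Proof.
move=> ab; have one : ascent 1%g a by rewrite /ascent !perm1 /=.
have two : ascent (s a * 1)%g b.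
  rewrite mulg1; apply: simple_tperm_mono => //=.
  by rewrite xpair_eqE -!val_eqE /=; lia.
have three : ascent (s b * (s a * 1))%g a.
  rewrite /ascent mulg1 !permM; apply: simple_tperm_mono.
    apply: simple_tperm_mono => //=.
    by rewrite xpair_eqE -!val_eqE /=; lia.
  rewrite xpair_eqE; apply/nandP; case: ab => ab.
    have [_ _ E] := simple_tperm_neighbours ab.
    by left; rewrite E simple_tperm_hi -E eq_sym -val_eqE /=; lia.
  have [_ _ E] := simple_tperm_neighbours ab.
  by right; rewrite -E simple_tperm_lo -val_eqE /=; lia.
rewrite !mulmxA left_stepE one scale0r addr0 -!scalemxAl left_stepE two.
rewrite scale0r addr0 -!scalemxAl left_stepE three scale0r addr0 !scalerA mulg1.
by rewrite !exprS expr0 mulr1 mulrA.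
Qed.

(** The generators are numbered from the last one, because the innermost factor
   of jucys_murphy is the pair of consecutive steps in the middle of a scan.
   Beyond the last index the value 1 satisfies every relation but the braid
   one. *)
Definition gen (m : nat) : 'M[R]_N :=
  if insub m is Some i then L (rev_ord i) else 1%:M.

Lemma genE (i : 'I_n.-1) : gen i = L (rev_ord i).
Proof. by rewrite /gen valK. Qed.

Lemma gen_out m : (n.-1 <= m)%N -> gen m = 1%:M.
Proof. by move=> nm; rewrite /gen insubF// ltnNge nm. Qed.

Variant gen_spec (m : nat) : 'M[R]_N -> Prop :=
  | GenIn (i : 'I_n.-1) of m = i :> nat : gen_spec m (L (rev_ord i))
  | GenOut of (n.-1 <= m)%N : gen_spec m 1%:M.

Lemma genP m : gen_spec m (gen m).
Proof.
have [mn|mn] := ltnP m n.-1; first by rewrite (genE (Ordinal mn)); constructor.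
by rewrite gen_out//; constructor.
Qed.

Lemma gen_sym m : (gen m)^T = gen m.
Proof. by case: genP => [i _|_]; rewrite ?trmx1// left_step_sym. Qed.

Lemma gen_far (a b : nat) : (a.+1 < b)%N -> comm_mx (gen a) (gen b).
Proof.
move=> ab; case: (genP a) => [i ai|_]; last exact/comm_mx_sym/comm_mx1.
case: (genP b) => [k bk|_]; last exact/comm_mx1.
apply/comm_mx_sym/left_step_far => //.
by have := ltn_ord k; rewrite /=; lia.
Qed.

Lemma gen_commutant m : commutant (@right_step R theta sigma n) (gen m).
Proof. by case: genP => [i _|_]; [exact: left_step_commutant | exact: commutant1]. Qed.

Lemma gen_quad m : sigma ^+ 2 = theta ->
  gen m *m gen m = (1 - theta) *: gen m + theta%:M.
Proof.
move=> sigma2; case: genP => [i _|_]; first exact: left_step_quad.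
by rewrite mulmx1 -[theta%:M]scalemx1 -scalerDl subrK scale1r.
Qed.

Hypothesis sigma_gt0 : 0 < sigma.

(** Both sides lie in the commutant and agree at 1. *)
Lemma left_step_braid i k : k = i.+1 :> nat ->
  L i *m L k *m L i = L k *m L i *m L k.
Proof.
move=> ki; have C a : commutant (@right_step R theta sigma n) (L a).
  exact: left_step_commutant.
apply: (commutant_inj sigma_gt0); try by do 2?apply: commutantM.
rewrite !left_step_walk; [|by left|by right].
by rewrite simple_tperm_braid.
Qed.

Lemma gen_braid m : (m.+1 < n.-1)%N ->
  gen m *m gen m.+1 *m gen m = gen m.+1 *m gen m *m gen m.+1.
Proof.
move=> mn; rewrite (genE (Ordinal mn)) (genE (Ordinal (ltnW mn))).
by apply/esym/left_step_braid => /=; lia.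
Qed.

End HeckeRelations.

(** * Sums over parabolic subgroups *)

Section Parabolic.
Variable n : nat.
Implicit Types (w u v : 'S_n) (i j k : 'I_n.-1) (x y : 'I_n).
Local Notation s i := (simple_tperm i).
Local Notation len := (@perm_length n).

(** The parabolic subgroup generated by the last m simple transpositions. *)
Definition tail_perms (m : nat) : {set 'S_n} :=
  [set u : 'S_n | [forall x : 'I_n, (x + m.+1 < n)%N ==> (u x == x)]].

Lemma tail_permsP m u :
  reflect (forall x, (x + m.+1 < n)%N -> u x = x) (u \in tail_perms m).
Proof.
rewrite inE; apply: (iffP forallP) => um x; last by apply/implyP => /um ->.
by move=> /(implyP (um x))/eqP.
Qed.

Lemma tail_perms_descent m u i : u \in tail_perms m -> ~~ ascent u i ->
  (n <= i + m.+1)%N /\ (s i * u)%g \in tail_perms m.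
Proof.
move=> /tail_permsP um des; have im : (n <= i + m.+1)%N.
  rewrite leqNgt; apply: contra des => im.
  rewrite /ascent um//= ltnNge; apply/negP => ui.
  have /perm_inj E : u (u (hi i)) = u (hi i) by apply: um; lia.
  by rewrite E /= ltnn in ui.
split=> //; apply/tail_permsP => x xm.
by rewrite permM (@simple_tperm_out _ i) ?um//; lia.
Qed.

(** The witness is the product of the adjacent exchanges from x up to y. *)
Lemma cycle_ex x y : (x <= y)%N -> exists c : 'S_n,
  [/\ c x = y, (len c <= y - x)%N & forall z : 'I_n, (z < x)%N -> c z = z].
Proof.
move: y; suff ex d y : (y = x + d :> nat)%N -> exists c : 'S_n,
    [/\ c x = y, (len c <= d)%N & forall z : 'I_n, (z < x)%N -> c z = z].
  by move=> y xy; apply: ex; rewrite subnKC.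
elim: d y => [|d IHd] y yE.
  exists 1%g; split=> [||z _]; rewrite ?perm1 ?perm_length1//.
  by apply/val_inj; rewrite /= yE addn0.
have xd : (x + d < n.-1)%N by have := ltn_ord y; lia.
pose i := Ordinal xd; have [c [cx lc cz]] := IHd (lo i) erefl.
exists (c * s i)%g; split=> [||z zx].
- by rewrite permM cx simple_tperm_lo; apply/val_inj; rewrite /= yE addnS.
- apply: leq_trans (perm_lengthM _ _) _; rewrite -(addn1 d) leq_add//.
  by have := perm_length_word [:: i]; rewrite big_seq1.
- by rewrite permM cz// simple_tperm_out//=; lia.
Qed.

Variables (R : realFieldType) (theta : R).
Hypotheses (theta_gt0 : 0 < theta) (theta_le1 : theta <= 1).

Definition tail_mass m : R := \sum_(u in tail_perms m) theta ^- len u.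

Lemma tail_mass_ge0 m : 0 <= tail_mass m.
Proof. by apply: sumr_ge0 => u _; rewrite invr_ge0 exprn_ge0// ltW. Qed.

(** Sorting the permutations by the image y of the first position they move,
   right translation by a cycle maps each class into the smaller group and
   changes the length by at most n - 1. *)
Lemma tail_massS m : (m.+1 < n)%N ->
  tail_mass m.+1 <= n%:R * theta ^- n.-1 * tail_mass m.
Proof.
move=> mn; have x0n : (n - m.+2 < n)%N by lia.
pose x0 := Ordinal x0n; rewrite /tail_mass (partition_big (fun w : 'S_n => w x0) predT)//=.
rewrite -mulrA -[n in n%:R]card_ord mulr_natl -sumr_const; apply: ler_sum => y _.
have [c cP lc] : exists2 c : 'S_n, forall u,
    (u * c)%g \in tail_perms m.+1 -> (u * c)%g x0 = y -> u \in tail_perms m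
    & (len c <= n.-1)%N.
  have [xy|yx] := leqP x0 y.
    have [c [cx lc cz]] := cycle_ex xy.
    exists c => [u /tail_permsP ucm ucx|]; last by have := ltn_ord y; lia.
    apply/tail_permsP => x xm; apply: (@perm_inj _ c); rewrite -permM.
    have [->|] := eqVneq x x0; first by rewrite ucx.
    rewrite -val_eqE /= => xx0.
    have xlt : (x < x0)%N by rewrite /=; lia.
    by rewrite cz// ucm//; move: xlt => /=; lia.
  exists 1%g; last by rewrite perm_length1.
  move=> u; rewrite mulg1 => /tail_permsP um ux; exfalso.
  have /perm_inj E : u y = u x0 by rewrite ux um//; move: yx => /=; lia.
  by rewrite E ltnn in yx.
rewrite (reindex_inj (mulIg c)) /= mulr_sumr.
rewrite [leRHS](bigID (fun u => ((u * c)%g \in tail_perms m.+1) && ((u * c)%g x0 == y))) /=.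
rewrite -[leLHS]addr0 lerD//; last first.
  by apply: sumr_ge0 => u _; rewrite mulr_ge0 ?invr_ge0 ?exprn_ge0// ltW.
rewrite [leRHS](eq_bigl (fun u => ((u * c)%g \in tail_perms m.+1) && ((u * c)%g x0 == y))).
  apply: ler_sum => u _; rewrite -invfM -exprD lef_pV2 ?posrE ?exprn_gt0//.
  apply: ler_wiXn2l => //; first exact: ltW.
  by apply: leq_trans (perm_lengthM _ _) _; rewrite addnC leq_add2r.
by move=> u /=; rewrite andb_idl// => /andP[a /eqP b]; apply: cP a b.
Qed.

Lemma tail_mass_le (k : nat) : (0 < n)%N -> (k < n)%N ->
  tail_mass n.-1 <= (n%:R * theta ^- n.-1) ^+ k * tail_mass (n.-1 - k).
Proof.
elim: k => [|k IHk] n0 kn; first by rewrite expr0 mul1r subn0.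
apply: le_trans (IHk n0 (ltnW kn)) _; rewrite exprSr -[leRHS]mulrA.
apply: ler_wpM2l.
  by rewrite exprn_ge0// mulr_ge0// invr_ge0 exprn_ge0// ltW.
have -> : (n.-1 - k = (n.-1 - k.+1).+1)%N by lia.
by apply: tail_massS; lia.
Qed.

Lemma tail_mass_full : (0 < n)%N -> tail_mass n.-1 = \sum_(u : 'S_n) theta ^- len u.
Proof.
move=> n0; apply: eq_bigl => u; apply/tail_permsP => x.
by rewrite prednK// => xn; have := ltn_ord x; lia.
Qed.

End Parabolic.

(** * Return estimate for the scan *)

Section ReturnBound.
Variables (R : rcfType) (theta sigma : R) (n : nat).
Implicit Types (w u v : 'S_n).
Local Notation N := #|{: 'S_n}|.
Local Notation s i := (simple_tperm i).
Local Notation len := (@perm_length n).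
Local Notation ev := (@basis R n).
Local Notation L := (@left_step R theta sigma n).
Local Notation g := (@gen R theta sigma n).
Local Notation e j := (orthproj (invariants g j)).
Local Notation o := (enum_rank (1%g : 'S_n)).

Lemma jucys_murphy_gen_scan :
  jucys_murphy g n.-1 =
    foldr (fun A B => A *m B) 1%:M [seq L i | i <- scan_order n].
Proof.
have foldr_mulmx_cat (t t' : seq 'M[R]_N) :
    foldr (fun A B => A *m B) 1%:M (t ++ t') =
    foldr (fun A B => A *m B) 1%:M t *m foldr (fun A B => A *m B) 1%:M t'.
  by elim: t => [|A t IHt] /=; rewrite ?mul1mx// IHt mulmxA.
have JE m : jucys_murphy g m =
    foldr (fun A B => A *m B) 1%:M (map g (rev (iota 0 m) ++ iota 0 m)).
  elim: m => [//|m IHm]; rewrite -[in RHS]addn1 iotaD rev_cat !map_cat !foldr_mulmx_cat.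
  by rewrite /= IHm map_cat foldr_mulmx_cat !mulmx1 !mulmxA.
rewrite JE /scan_order !map_cat; congr (foldr _ _ _).
have rev_enum : [seq rev_ord i | i <- enum 'I_n.-1] = rev (enum 'I_n.-1).
  apply: (inj_map val_inj); rewrite map_rev val_enum_ord.
  apply: (@eq_from_nth _ 0%N) => [|k].
    by rewrite 2!size_map size_rev size_iota size_enum_ord.
  rewrite 2!size_map size_enum_ord => kn.
  have o' : 'I_n.-1 by exists k.
  rewrite nth_rev ?size_iota// nth_iota; last lia.
  by rewrite -map_comp (nth_map o') ?size_enum_ord//= nth_enum_ord// add0n.
have gL : map g (iota 0 n.-1) = [seq L i | i <- rev (enum 'I_n.-1)].
  by rewrite -rev_enum -map_comp -val_enum_ord -map_comp; apply: eq_map => i /=; rewrite genE.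
by rewrite map_rev gL -map_rev revK.
Qed.

Hypotheses (sigma_gt0 : 0 < sigma) (sigma2 : sigma ^+ 2 = theta).
Hypotheses (theta_gt0 : 0 < theta) (theta_le1 : theta <= 1) (n_gt0 : (0 < n)%N).

(** Invariance under a step relates the values at u and at s i * u when i is a
   descent of u, so that one value determines all those on the parabolic
   subgroup. *)
Lemma invariants_tail m (v : 'rV[R]_N) (u : 'S_n) : (m < n)%N ->
  (v <= invariants g m)%MS -> u \in tail_perms n m ->
  v 0 (enum_rank u) = sigma ^- len u * v 0 o.
Proof.
move=> mn /invariantsP vg; have [d] := ubnP (len u); elim: d u => // d IHd u.
have [->|u1] := eqVneq u 1%g; first by rewrite perm_length1 invr1 mul1r.
have [i des] := perm_length_descent_ex u1; rewrite (perm_length_descent des) ltnS.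
move=> lud um; have [nim sum] := tail_perms_descent um des.
have /vg : (rev_ord i < m)%N by have := ltn_ord i; rewrite /=; lia.
rewrite genE rev_ordK => /(congr1 (fun w : 'rV[R]_N => (w *m (ev u)^T) 0 0)).
have entry w : (v *m (ev w)^T) 0 0 = v 0 (enum_rank w).
  by rewrite basis.unlock trmx_delta -colE mxE.
rewrite -mulmxA -{1}left_step_sym -trmx_mul left_stepE (negbTE des) linearD !linearZ.
rewrite mulmxDr -!scalemxAr [LHS]mxE [X in X + _]mxE [X in _ + X]mxE !entry /stay.
rewrite (IHd _ lud sum) => vu; apply: (mulfI (lt0r_neq0 theta_gt0)).
have -> : theta * v 0 (enum_rank u) = v 0 (enum_rank u) - (1 - theta) * v 0 (enum_rank u).
  by ring.
rewrite -{1}vu addrK -sigma2 [sigma ^+ (len _).+1]exprS invfM expr2 !mulrA.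
by rewrite mulfK// lt0r_neq0.
Qed.

(** With t the trace, the row of the projection at 1 has squared norm t and value t
   at 1; summing only the squares given by invariants_tail yields Z t^2 <= t. *)
Lemma invariants_trace_le m : (m < n)%N -> tail_mass n theta m * e m o o <= 1.
Proof.
move=> mn; set t := e m o o.
have tE : t = sqnorm (row o (e m)) by apply/orthproj_trace/orthprojP.
have t_ge0 : 0 <= t by rewrite tE sqnorm_ge0.
have [->|t0] := eqVneq t 0; first by rewrite mulr0.
have t_gt0 : 0 < t by rewrite lt_def t0.
rewrite -(ler_pM2l t_gt0) mulr1 {3}tE sqnormE.
rewrite (reindex_onto enum_rank enum_val) /=; last by move=> a _; rewrite enum_valK.
rewrite [leRHS](bigID (mem (tail_perms n m))) /= -[leLHS]addr0 lerD//; last first.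
  by apply: sumr_ge0 => u _; rewrite sqr_ge0.
rewrite mulrCA /tail_mass mulr_suml big_mkcond [leRHS]big_mkcond; apply: ler_sum => u _ /=.
rewrite enum_rankK eqxx /=; case: ifP => // um.
rewrite (invariants_tail mn _ um); last by apply: submx_trans (row_sub _ _) (orthproj_sub _).
by rewrite mxE -/t exprMn exprVn -exprM mulnC exprM sigma2 expr2.
Qed.

(** The left-hand side is the sum, over all w, of K^l(1,w)^2 / pi(w). *)
Lemma scan_return_le l :
  (\sum_(v : 'S_n) theta ^- len v) *
    sqnorm (iter l (mulmx^~ (jucys_murphy g n.-1)) (ev 1%g)) <=
  \sum_(k < n) (theta ^+ (2 * l) * n%:R ^+ 2 * theta ^- n.-1) ^+ k.
Proof.
have Rsym := @right_step_sym R theta sigma n.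
have := @hecke_return_le R N theta theta_gt0 theta_le1 n.-1 g
  (gen_sym theta sigma n) (fun m => gen_quad n m sigma2) (gen_braid theta sigma_gt0)
  (gen_far theta sigma n) _ _ o Rsym
  (gen_commutant theta sigma (n := n)) (commutant_traceC sigma_gt0) l.
rewrite prednK// -(tail_mass_full theta_gt0) // basis.unlock => le_ret.
have Z0 := tail_mass_ge0 n theta_gt0.
apply: le_trans (ler_wpM2l (Z0 _) le_ret) _; rewrite mulr_sumr.
apply: ler_sum => k _; have kn : (k < n)%N := ltn_ord k.
have e0 := orthproj_trace_ge0 o (orthprojP (invariants g (n.-1 - k))).
have le1 := @invariants_trace_le (n.-1 - k) ltac:(lia).
have Zk := tail_mass_le theta_gt0 theta_le1 n_gt0 kn.
apply: (@le_trans _ _ (theta ^+ (2 * l * k) * (n ^ k)%:R *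
   ((n%:R * theta ^- n.-1) ^+ k * (tail_mass n theta (n.-1 - k) * e (n.-1 - k)%N o o)))).
  rewrite [leLHS]mulrC -!mulrA; do 2?[rewrite ler_wpM2l ?exprn_ge0 ?(ltW theta_gt0)//].
  by rewrite [leLHS]mulrC !mulrA ler_wpM2r.
set X := tail_mass _ _ _ * _ in le1 *; set y := theta ^- n.-1.
have -> : (theta ^+ (2 * l) * n%:R ^+ 2 * y) ^+ k =
    theta ^+ (2 * l * k) * (n ^ k)%:R * (n%:R * y) ^+ k.
  by rewrite !exprMn -!exprM natrX !mulrA.
rewrite mulrA ler_piMr// mulr_ge0 ?mulr_ge0 ?exprn_ge0 ?(ltW theta_gt0)//.
by rewrite mulr_ge0// invr_ge0 exprn_ge0// ltW.
Qed.

End ReturnBound.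

(** * Total variation and chi-square distances *)

Section TotalVariation.
Variables (R : realType) (T : finType) (mu nu : T -> R).
Hypotheses (mu1 : \sum_x mu x = 1) (nu1 : \sum_x nu x = 1).

Lemma tv_dist_le c : 0 <= c ->
  (forall A : {set T}, `|\sum_(x in A) mu x - \sum_(x in A) nu x| <= c) ->
  tv_dist mu nu <= c.
Proof. by move=> c0 le; apply: bigmax_le. Qed.

Lemma tv_dist_ge (A : {set T}) :
  `|\sum_(x in A) mu x - \sum_(x in A) nu x| <= tv_dist mu nu.
Proof. exact: (le_bigmax _ (fun A : {set T} => `|\sum_(x in A) mu x - \sum_(x in A) nu x|)). Qed.

Lemma tv_dist_ge0 : 0 <= tv_dist mu nu.
Proof. by apply: le_trans (tv_dist_ge finset.set0). Qed.

Lemma tv_dist_le1 : (forall x, 0 <= mu x) -> (forall x, 0 <= nu x) ->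
  tv_dist mu nu <= 1.
Proof.
move=> mu0 nu0; apply: tv_dist_le => // A.
have sub (f : T -> R) : (forall x, 0 <= f x) -> \sum_x f x = 1 -> 0 <= \sum_(x in A) f x <= 1.
  move=> f0 <-; rewrite sumr_ge0//= [leRHS](bigID (mem A)) /= lerDl.
  exact: sumr_ge0.
have /andP[a0 a1] := sub _ mu0 mu1; have /andP[b0 b1] := sub _ nu0 nu1.
by rewrite ler_norml; apply/andP; split; lra.
Qed.

(** Twice mu(A) - nu(A) is the sum of the differences with sign + on A and - off A,
   as these differences sum to 0; then Cauchy-Schwarz with weight nu. *)
Lemma tv_dist_chi2 : (forall x, 0 < nu x) ->
  tv_dist mu nu ^+ 2 <= (\sum_x mu x ^+ 2 / nu x - 1) / 4.
Proof.
move=> nu0; set chi := \sum_x _ - 1.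
have chiE : chi = \sum_x (mu x - nu x) ^+ 2 / nu x.
  rewrite /chi; under [RHS]eq_bigr => x _.
    rewrite (_ : _ / _ = mu x ^+ 2 / nu x - mu x *+ 2 + nu x); last first.
      by field; rewrite lt0r_neq0.
    over.
  by rewrite big_split sumrB /= sumrMnl mu1 nu1 mulr2n opprD -addrA subrK.
have sgn (A : {set T}) : (\sum_(x in A) mu x - \sum_(x in A) nu x) ^+ 2 <= chi / 4.
  pose eps x : R := if x \in A then 1 else -1.
  set S := \sum_(x in A) mu x - \sum_(x in A) nu x.
  have SE : 2 * S = \sum_x eps x * (mu x - nu x).
    have d0 : \sum_(x in A) (mu x - nu x) + \sum_(x | x \notin A) (mu x - nu x) = 0.
      by rewrite -(bigID (mem A) predT) /= sumrB mu1 nu1 subrr.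
    rewrite (bigID (mem A)) /= (eq_bigr (fun x => mu x - nu x)); last first.
      by move=> x xA; rewrite /eps xA mul1r.
    rewrite [X in _ = _ + X](eq_bigr (fun x => - (mu x - nu x))); last first.
      by move=> x /negbTE xA; rewrite /eps xA mulN1r.
    by rewrite [X in _ = _ + X]sumrN /S -sumrB; lra.
  (* Cauchy-Schwarz, as the positivity of a variance with respect to nu. *)
  have : 0 <= \sum_x nu x * (eps x * (mu x - nu x) / nu x - 2 * S) ^+ 2.
    by apply: sumr_ge0 => x _; rewrite mulr_ge0 ?sqr_ge0 ?ltW.
  under eq_bigr => x _.
    rewrite (_ : _ * _ = (mu x - nu x) ^+ 2 / nu x
      - (4 * S) * (eps x * (mu x - nu x)) + (2 * S) ^+ 2 * nu x); last first.
      have e2 : eps x ^+ 2 = 1 by rewrite /eps; case: ifP => _; rewrite ?sqrrN expr1n.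
      have <- : eps x ^+ 2 * (mu x - nu x) ^+ 2 / nu x = (mu x - nu x) ^+ 2 / nu x.
        by rewrite e2 mul1r.
      by field; rewrite lt0r_neq0.
    over.
  rewrite big_split sumrB /= -!mulr_sumr nu1 -SE -chiE; nra.
have chi0 : 0 <= chi / 4 by apply: le_trans (sgn finset.set0); rewrite sqr_ge0.
rewrite -[leRHS]sqr_sqrtr// lerXn2r ?nnegrE ?sqrtr_ge0 ?tv_dist_ge0//.
apply: tv_dist_le => [|A]; first exact: sqrtr_ge0.
by rewrite -sqrtr_sqr ler_sqrt.
Qed.

End TotalVariation.

(** * From transition kernels to symmetric matrices *)

Section ScanKernel.
Variables (R : realType) (theta : R) (n : nat).
Hypotheses (theta_gt0 : 0 < theta) (theta_le1 : theta <= 1).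
Implicit Types (w u v : 'S_n).
Local Notation N := #|{: 'S_n}|.
Local Notation len := (@perm_length n).
Local Notation K := (systematic_scan theta n).
Local Notation sigma := (Num.sqrt theta).
Local Notation kernel := (trans_kernel R 'S_n).

Lemma metropolis_stepE i w w' : metropolis_step theta i w w' =
  if ascent w i then (w' == simple_tperm i * w)%g%:R
  else theta * (w' == simple_tperm i * w)%g%:R + (1 - theta) * (w' == w)%:R.
Proof. by rewrite /metropolis_step ascent_length. Qed.

(** P is the conjugate of the matrix A by the diagonal matrix of the powers
   sigma ^+ len w. *)
Definition represents (P : kernel) (A : 'M[R]_N) := forall w w',
  P w w' * sigma ^+ len w' = sigma ^+ len w * A (enum_rank w) (enum_rank w').

Lemma represents1 : represents (@trans_id R _) 1%:M.
Proof.
move=> w w'; rewrite /trans_id mxE (inj_eq enum_rank_inj).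
by have [->|_] := eqVneq w w'; rewrite ?mul0r ?mulr0 ?mul1r ?mulr1.
Qed.

Lemma representsM P Q A B : represents P A -> represents Q B ->
  represents (trans_comp P Q) (A *m B).
Proof.
move=> PA QB w w'; rewrite /trans_comp mxE mulr_suml mulr_sumr.
rewrite [RHS](reindex_onto enum_rank enum_val) /=; last by move=> a _; rewrite enum_valK.
apply: eq_big => u; rewrite ?enum_rankK ?eqxx// => _.
by rewrite -mulrA QB mulrA PA mulrA.
Qed.

Lemma represents_step i :
  represents (metropolis_step theta i) (left_step theta sigma i).
Proof.
have sg : sigma ^+ 2 = theta by rewrite sqr_sqrtr// ltW.
move=> w w'; rewrite metropolis_stepE left_step.unlock !mxE enum_rankK !basisE.
case: (boolP (ascent w i)) => asc; rewrite /stay ?mul0r ?addr0.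
  have [->|_] := eqVneq w' (simple_tperm i * w)%g; last by rewrite !mulr0 mul0r.
  by rewrite perm_length_ascent// exprSr mul1r mulr1.
rewrite mulrDl mulrDr; congr (_ + _).
  have [->|_] := eqVneq w' (simple_tperm i * w)%g; last by rewrite !mulr0 mul0r.
  by rewrite (perm_length_descent asc) exprSr -{1}sg expr2 !mulr1 mulrC mulrA.
by have [->|_] := eqVneq w' w; rewrite ?mulr0 ?mul0r// !mulr1 mulrC.
Qed.

Lemma represents_scan :
  represents K (foldr (fun A B => A *m B) 1%:M
                  [seq left_step theta sigma i | i <- scan_order n]).
Proof.
rewrite /systematic_scan; elim: (scan_order n) => [|i t IHt] /=.
  exact: represents1.
exact/representsM/IHt/represents_step.
Qed.

Lemma trans_pow_scan l w :
  trans_pow K l 1%g w * sigma ^+ len w =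
  (iter l (mulmx^~ (jucys_murphy (@gen R theta sigma n) n.-1)) (@basis R n 1%g))
    0 (enum_rank w).
Proof.
rewrite jucys_murphy_gen_scan; set A := foldr _ _ _.
have rep : represents (trans_pow K l) (iter l (mulmx^~ A) 1%:M).
  by elim: l => [|l IHl]; [exact: represents1 | apply: representsM represents_scan].
rewrite rep perm_length1 expr0 mul1r.
have -> : iter l (mulmx^~ A) (@basis R n 1%g) = @basis R n 1%g *m iter l (mulmx^~ A) 1%:M.
  by elim: l {rep} => [|l IHl]; rewrite ?mulmx1// !iterS IHl mulmxA.
by rewrite basis.unlock -rowE mxE.
Qed.

Lemma stationary_dist_gt0 w : 0 < stationary_dist theta n w.
Proof.
rewrite divr_gt0 ?invr_gt0 ?exprn_gt0//.
by apply: lt_le_trans (_ : theta ^- len w <= _); rewrite ?invr_gt0 ?exprn_gt0//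
  (bigD1 w) //= lerDl sumr_ge0// => v _; rewrite invr_ge0 exprn_ge0// ltW.
Qed.

Lemma stationary_dist_sum : \sum_w stationary_dist theta n w = 1.
Proof.
rewrite -mulr_suml divff// gt_eqF// (bigD1 (1%g : 'S_n)) //= ltr_pwDl//.
  by rewrite invr_gt0 exprn_gt0.
by rewrite sumr_ge0// => v _; rewrite invr_ge0 exprn_ge0// ltW.
Qed.

Lemma scan_chi2 l :
  \sum_w trans_pow K l 1%g w ^+ 2 / stationary_dist theta n w =
  (\sum_(v : 'S_n) theta ^- len v) *
    sqnorm (iter l (mulmx^~ (jucys_murphy (@gen R theta sigma n) n.-1))
              (@basis R n 1%g)).
Proof.
rewrite sqnormE mulr_sumr [RHS](reindex_onto enum_rank enum_val) /=; last first.
  by move=> a _; rewrite enum_valK.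
apply: eq_big => w; rewrite ?enum_rankK ?eqxx// => _.
rewrite -trans_pow_scan exprMn -exprM mulnC exprM sqr_sqrtr ?ltW//.
by rewrite /stationary_dist invf_div invrK mulrCA.
Qed.

End ScanKernel.

(** * The upper bound *)

Section UpperBound.
Variables (R : realType) (theta : R) (n : nat).
Hypotheses (theta_gt0 : 0 < theta) (theta_le1 : theta <= 1) (n_gt0 : (0 < n)%N).
Local Notation K := (systematic_scan theta n).
Local Notation pi := (stationary_dist theta n).

Lemma metropolis_step_ge0 i w w' : 0 <= metropolis_step theta (n := n) i w w'.
Proof.
rewrite metropolis_stepE; case: ifP => _ //.
by rewrite addr_ge0// mulr_ge0// ?subr_ge0// ltW.
Qed.

Lemma metropolis_step_sum i w : \sum_w' metropolis_step theta (n := n) i w w' = 1.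
Proof.
have one (v : 'S_n) : \sum_w' ((w' == v)%:R : R) = 1.
  by rewrite (bigD1 v) //= eqxx big1 ?addr0// => u /negbTE ->.
under eq_bigr => w' _ do rewrite metropolis_stepE.
case: (ascent w i); first exact: one.
by rewrite big_split /= -!mulr_sumr !one !mulr1 addrC subrK.
Qed.

Definition stochastic (T : finType) (P : trans_kernel R T) :=
  (forall x y, 0 <= P x y) /\ (forall x, \sum_y P x y = 1).

Lemma stochastic_id T : stochastic (@trans_id R T).
Proof.
split=> [x y|x]; first by rewrite /trans_id.
by rewrite (bigD1 x) //= /trans_id eqxx big1 ?addr0// => y; rewrite eq_sym => /negbTE ->.
Qed.

Lemma stochastic_comp T (P Q : trans_kernel R T) :
  stochastic P -> stochastic Q -> stochastic (trans_comp P Q).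
Proof.
move=> [P0 P1] [Q0 Q1]; split=> [x y|x].
  by apply: sumr_ge0 => z _; rewrite mulr_ge0.
rewrite /trans_comp exchange_big -[RHS](P1 x); apply: eq_bigr => z _ /=.
by rewrite -mulr_sumr Q1 mulr1.
Qed.

Lemma stochastic_scan : stochastic K.
Proof.
rewrite /systematic_scan; elim: (scan_order n) => [|i t IHt] /=.
  exact: stochastic_id.
apply: stochastic_comp => //; split; first exact: metropolis_step_ge0.
exact: metropolis_step_sum.
Qed.

Lemma stochastic_pow l : stochastic (trans_pow K l).
Proof.
by elim: l => [|l IHl]; [exact: stochastic_id | apply: stochastic_comp stochastic_scan].
Qed.

(** The chi-square distance is at most the sum of x^k for 1 <= k < n.  A quarter of
   it is at most x when x <= 3/4, and otherwise the right-hand side is at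
   least 1. *)
Lemma scan_tv_le (l : nat) x :
  x = theta ^+ (2 * l) * n%:R ^+ 2 * theta ^- n.-1 ->
  tv_dist (trans_pow K l 1%g) pi ^+ 2 <= expR x - 1.
Proof.
move=> xE; have [K0 K1] := stochastic_pow l.
have pi0 w : 0 < pi w by exact: stationary_dist_gt0.
have pi1 : \sum_w pi w = 1 by exact: stationary_dist_sum.
have x0 : 0 <= x by rewrite xE !mulr_ge0 ?exprn_ge0 ?invr_ge0 ?exprn_ge0 ?(ltW theta_gt0).
have tv0 := tv_dist_ge0 (trans_pow K l 1%g) pi.
have [x34|x34] := leP x (3 / 4).
  have := tv_dist_chi2 (K1 1%g) pi1 pi0; rewrite scan_chi2// => /le_trans; apply.
  have sg : 0 < Num.sqrt theta by rewrite sqrtr_gt0.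
  have := scan_return_le sg (sqr_sqrtr (ltW theta_gt0)) theta_gt0 theta_le1 n_gt0 l.
  rewrite -xE; set S := \sum_(k < n) _ => leS.
  have SE : (1 - x) * S = 1 - x ^+ n.
    by rewrite -opprB mulNr -subrX1 opprB.
  have xn : 0 <= x ^+ n by rewrite exprn_ge0.
  have := @expR_ge1Dx R x.
  set Z := _ * sqnorm _ in leS *.
  by nra.
have tv1 := tv_dist_le1 (K1 1%g) pi1 (K0 1%g) (fun w => ltW (pi0 w)).
(* expR x is the eighth power of expR (x / 8) >= 1 + 3 / 32. *)
have e2 : 2 <= expR x.
  have -> : x = 8%:R * (x / 8%:R) by rewrite mulrC divfK.
  rewrite expRM_natl.
  have := @expR_ge1Dx R (x / 8%:R); set y := expR _ => y1.
  have y1' : 35 / 32 <= y by lra.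
  have y2 : 1196 / 1000 <= y ^+ 2 by nra.
  have y4 : 143 / 100 <= y ^+ 4 by rewrite (exprM y 2 2); nra.
  by rewrite (exprM y 4 2); nra.
by rewrite (le_trans (_ : _ <= 1)) ?expr_le1//; lra.
Qed.

End UpperBound.

(** * Confinement of the first scans *)

Section Confinement.
Variables (R : realType) (theta : R) (n : nat).
Implicit Types (w u v : 'S_n) (i j : 'I_n.-1) (A B C : pred 'S_n).
Local Notation s i := (simple_tperm i).
Local Notation len := (@perm_length n).
Local Notation kernel := (trans_kernel R 'S_n).
Local Notation K := (systematic_scan theta n).

Definition carries (P : kernel) A B :=
  forall w w', A w -> ~~ B w' -> P w w' = 0.

Lemma carries_comp P Q A B C :
  carries P A B -> carries Q B C -> carries (trans_comp P Q) A C.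
Proof.
move=> PAB QBC w w' Aw Cw'; rewrite /trans_comp big1// => u _.
by case: (boolP (B u)) => Bu; [rewrite (QBC u)// mulr0 | rewrite (PAB w)// mul0r].
Qed.

Lemma carries_id A : carries (@trans_id R 'S_n) A A.
Proof.
move=> w w' Aw; rewrite /trans_id; case: eqP => // <-.
by rewrite Aw.
Qed.

Lemma carries_step i A B :
  (forall w, A w -> B w /\ B (s i * w)%g) -> carries (metropolis_step theta i) A B.
Proof.
move=> AB w w' /AB[Bw Bsw] Bw'; rewrite metropolis_stepE.
have /negbTE -> : w' != w by apply: contraNneq Bw' => ->.
have /negbTE -> : w' != (s i * w)%g by apply: contraNneq Bw' => ->.
by case: ifP; rewrite // !mulr0 addr0.
Qed.

Definition scan_list (t : seq 'I_n.-1) : kernel :=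
  foldr (@trans_comp R 'S_n) (@trans_id R 'S_n) [seq metropolis_step theta i | i <- t].

Lemma carries_cat t t' A B C :
  carries (scan_list t) A B -> carries (scan_list t') B C ->
  carries (scan_list (t ++ t')) A C.
Proof.
suff E w w' : scan_list (t ++ t') w w' = trans_comp (scan_list t) (scan_list t') w w'.
  by move=> tA tB w w' Aw Cw'; rewrite E (carries_comp tA tB).
elim: t w w' => [|i t IHt] w w'.
  have E u : scan_list [::] w u = (w == u)%:R by [].
  rewrite /trans_comp (bigD1 w)//= E eqxx mul1r big1 ?addr0// => u.
  by rewrite E eq_sym => /negbTE ->; rewrite mul0r.
have E t1 u v : scan_list (i :: t1) u v =
    trans_comp (metropolis_step theta i) (scan_list t1) u v.
  by [].
rewrite E /trans_comp; under eq_bigr => u _ do rewrite IHt /trans_comp mulr_sumr.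
under [RHS]eq_bigr => u _ do rewrite E.
rewrite exchange_big; apply: eq_bigr => u _ /=.
by rewrite mulr_suml; apply: eq_bigr => v _; rewrite mulrA.
Qed.

Lemma carries_seq1 i A B :
  carries (metropolis_step theta i) A B -> carries (scan_list [:: i]) A B.
Proof. by move=> iAB; rewrite /scan_list /=; apply: (carries_comp iAB (@carries_id B)). Qed.

Lemma carries_stable t A :
  (forall i, i \in t -> forall w, A w -> A (s i * w)%g) -> carries (scan_list t) A A.
Proof.
elim: t => [|i t IHt] tA; first exact: carries_id.
have tA' : carries (scan_list t) A A.
  by apply: IHt => k kt; apply: tA; rewrite inE kt orbT.
rewrite /scan_list /= -/(scan_list t); apply: carries_comp tA'.
by apply: carries_step => w Aw; split=> //; apply: tA; rewrite ?mem_head.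
Qed.

Variable a : nat.

Definition crossed w : nat := \sum_(x < n | (x < a)%N) (a <= w x)%N.

Lemma crossed1 : crossed 1%g = 0%N.
Proof. by rewrite /crossed big1// => x xa; rewrite perm1 leqNgt xa. Qed.

Lemma crossed_other i w : i.+1 != a -> crossed (s i * w)%g = crossed w.
Proof.
move=> ia; rewrite /crossed [RHS](reindex_inj (@perm_inj _ (s i))) /=.
apply: eq_big => [x|x _]; last by rewrite permM.
rewrite /simple_tperm; case: tpermP => [->|->|//] /=; lia.
Qed.

Lemma crossed_boundary i w : i.+1 = a ->
  (crossed (s i * w)%g + (a <= w (lo i)) = crossed w + (a <= w (hi i)))%N.
Proof.
move=> ia; have la : (lo i < a)%N by rewrite -ia /=.
have X : (\sum_(x < n | (x < a) && (x != lo i)) (a <= (s i * w)%g x) =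
            \sum_(x < n | (x < a) && (x != lo i)) (a <= w x))%N.
  apply: eq_bigr => x /andP[xa]; rewrite -val_eqE /= => xi.
  by rewrite permM simple_tperm_out// -?val_eqE ?ia ?ltn_eqF.
rewrite /crossed (bigD1 (lo i)) //= X (bigD1 (lo i) (P := fun x => (x < a)%N)) //=.
by rewrite permM simple_tperm_lo addnC -[RHS]addnA; congr addn; rewrite addnC.
Qed.

(** The boundary bond is visited twice per scan, and its left end is not moved
   in between: a large letter that has just crossed is still there at the second
   visit, so that the second visit cannot bring in another one. *)
Lemma carries_scan c : (0 < a < n)%N ->
  carries K [pred w | (crossed w <= c)%N] [pred w | (crossed w <= c.+1)%N].
Proof.
move=> /andP[a0 an]; have i0n : (a.-1 < n.-1)%N by lia.
pose i0 := Ordinal i0n; have i0a : i0.+1 = a by rewrite /= prednK.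
rewrite /systematic_scan -/(scan_list _) /scan_order.
have : i0 \in enum 'I_n.-1 by rewrite mem_enum.
have := enum_uniq 'I_n.-1; have := iota_ltn_sorted 0 n.-1; rewrite -val_enum_ord.
move=> srt unq i0e; case/splitPr: i0e srt unq => t1 t2 srt unq.
have t1i i : i \in t1 -> i.+1 != a.
  move=> it1; apply/eqP => ia; move: unq; rewrite cat_uniq => /and3P[_ /hasPn nt _].
  have := nt i0 (mem_head _ _) => /=; have -> : i0 = i by apply/val_inj; rewrite /= -ia.
  by rewrite it1.
have t2i i : i \in t2 -> (i0 < i)%N.
  move: srt; rewrite map_cat => /cat_sorted2[_ /= /(order_path_min ltn_trans)/allP lt].
  by move=> it2; apply: lt; apply: map_f.
have t2a i : i \in t2 -> i.+1 != a.
  by move=> /t2i ii; rewrite -i0a eqSS gtn_eqF.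
(* P1 holds between the two visits to the boundary bond. *)
pose P1 := [pred w | (crossed w <= c + (a <= w (lo i0)))%N].
have mid t : {subset t <= t2} -> carries (scan_list t) P1 P1.
  move=> tt2; apply: carries_stable => i it w /=.
  rewrite crossed_other ?permM ?t2a ?tt2// simple_tperm_out//=.
    by rewrite ltn_eqF// t2i// tt2.
  by rewrite ltn_eqF// ltnS ltnW// t2i// tt2.
have out t b : {subset t <= t1} ->
    carries (scan_list t) [pred w | (crossed w <= b)%N] [pred w | (crossed w <= b)%N].
  by move=> tt1; apply: carries_stable => i it w /=; rewrite crossed_other// t1i// tt1.
rewrite -cat1s !rev_cat -!catA.
apply: carries_cat (out t1 c _) _ => //.
apply: (carries_cat (B := P1)).
  apply/carries_seq1/carries_step => w /= wc; split; first exact: leq_trans wc (leq_addr _ _).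
  rewrite permM simple_tperm_lo; apply: leq_trans (leq_addr (a <= w (lo i0)) _) _.
  by rewrite (crossed_boundary w i0a) leq_add2r.
apply: carries_cat (mid t2 _) _ => //.
apply: carries_cat (mid (rev t2) _) _ => [i|]; first by rewrite mem_rev.
apply: carries_cat (out (rev t1) c.+1 _) => [|i]; last by rewrite mem_rev.
apply/carries_seq1/carries_step => w /= wc.
split; first by apply: leq_trans wc _; rewrite -addn1 leq_add2l leq_b1.
rewrite -(leq_add2r (a <= w (lo i0))) (crossed_boundary w i0a).
by rewrite addSn -addn1 leq_add ?leq_b1.
Qed.

Lemma crossed_pow_sum l : (0 < a < n)%N -> 0 < theta -> theta <= 1 ->
  \sum_(w in [set w : 'S_n | (crossed w <= l)%N]) trans_pow K l 1%g w = 1.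
Proof.
move=> an t0 t1; have [_ K1] := stochastic_pow n t0 t1 l.
rewrite -[RHS](K1 1%g) [RHS](bigID (mem [set w : 'S_n | (crossed w <= l)%N])) /=.
rewrite [X in _ + X]big1 ?addr0// => w; rewrite inE => wl.
suff pow : carries (trans_pow K l) [pred w | (crossed w <= 0)%N]
    [pred w | (crossed w <= l)%N] by apply: pow; rewrite //= crossed1.
elim: l {K1 wl} => [|l IHl]; first exact: carries_id.
rewrite /trans_pow iterS -/(trans_pow K l); apply: (carries_comp IHl).
exact: carries_scan.
Qed.

End Confinement.

(** * Stationary mass of the permutations with many noninversions *)

Section StationaryMass.
Variables (R : realType) (theta : R) (n : nat).
Hypotheses (theta_gt0 : 0 < theta) (theta_le1 : theta <= 1).
Implicit Types (w u v : 'S_n).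
Local Notation len := (@perm_length n).

Definition noninversions w : {set 'I_n * 'I_n} :=
  [set p : 'I_n * 'I_n | (p.1 < p.2)%N && (w p.1 < w p.2)%N].

Lemma card_noninversions w :
  (len w + #|noninversions w| = #|[set p : 'I_n * 'I_n | (p.1 < p.2)%N]|)%N.
Proof.
rewrite perm_length_inversions -cardsUI [X in (_ + X)%N](_ : _ = 0%N) ?addn0.
  congr #|pred_of_set _|; apply/setP => -[x y]; rewrite !inE /= -andb_orr.
  rewrite andb_idr// => xy; have := ltngtP (w x) (w y); case=> // /val_inj/perm_inj E.
  by rewrite E ltnn in xy.
by apply/eqP; rewrite cards_eq0; apply/eqP/setP => -[x y]; rewrite !inE /=; lia.
Qed.

Lemma perm_length_rev :
  len (perm (@rev_ord_inj n)) = #|[set p : 'I_n * 'I_n | (p.1 < p.2)%N]|.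
Proof.
rewrite perm_length_inversions; congr #|pred_of_set _|.
apply/setP => -[x y]; rewrite !inE /= !permE /=.
by have := ltn_ord x; have := ltn_ord y; lia.
Qed.

(** The normalizing sum is at least its term at the longest permutation, whose
   length is that of w plus the number of noninversions of w. *)
Lemma stationary_dist_le w : stationary_dist theta n w <= theta ^+ #|noninversions w|.
Proof.
rewrite /stationary_dist ler_pdivrMr; last first.
  rewrite (bigD1 w) //= ltr_pwDl ?invr_gt0 ?exprn_gt0// sumr_ge0// => v _.
  by rewrite invr_ge0 exprn_ge0// ltW.
rewrite (bigD1 (perm (@rev_ord_inj n))) //= mulrDr -[leLHS]addr0 lerD//; last first.
  rewrite mulr_ge0 ?exprn_ge0 ?(ltW theta_gt0)// sumr_ge0// => v _.
  by rewrite invr_ge0 exprn_ge0// ltW.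
rewrite perm_length_rev -(card_noninversions w) exprD invfM mulrCA divff ?mulr1//.
by rewrite expf_neq0// lt0r_neq0.
Qed.

(** Every small letter of the first a positions forms a noninversion with every
   large letter of the other positions, and there are at least a - crossed a w
   letters of both kinds. *)
Lemma noninversions_ge w a : (a.*2 <= n)%N ->
  ((a - crossed a w) ^ 2 <= #|noninversions w|)%N.
Proof.
move=> an; pose lowL := [set x : 'I_n | (x < a)%N && (w x < a)%N].
pose hiR := [set x : 'I_n | (a <= x)%N && (a <= w x)%N].
pose hiL := [set x : 'I_n | (x < a)%N && (a <= w x)%N].
have card_lt : #|[set x : 'I_n | (x < a)%N]| = a.
  have a_n : (a <= n)%N by lia.
  by rewrite cardsE -sum1_card -(big_ord_widen n (fun=> 1%N) a_n) sum1_card card_ord.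
have hE : crossed a w = #|hiL|.
  rewrite /crossed -sum1_card big_mkcond [RHS]big_mkcond; apply: eq_bigr => x _.
  by rewrite inE; case: (x < a)%N; case: (a <= w x)%N.
have LE : (#|lowL| + #|hiL| = a)%N.
  rewrite -[RHS]card_lt -cardsUI [X in (_ + X)%N](_ : _ = 0%N) ?addn0.
    by congr #|pred_of_set _|; apply/setP => x; rewrite !inE /=; lia.
  by apply/eqP; rewrite cards_eq0; apply/eqP/setP => x; rewrite !inE /=; lia.
have RE : (#|hiR| + #|hiL| = n - a)%N.
  have <- : #|w @^-1: ~: [set x : 'I_n | (x < a)%N]| = (n - a)%N.
    rewrite card_preimset; last exact: perm_inj.
    by rewrite -[n in RHS]card_ord -(cardsC [set x : 'I_n | (x < a)%N]) card_lt addKn.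
  rewrite -cardsUI [X in (_ + X)%N](_ : _ = 0%N) ?addn0.
    by congr #|pred_of_set _|; apply/setP => x; rewrite !inE /=; lia.
  by apply/eqP; rewrite cards_eq0; apply/eqP/setP => x; rewrite !inE /=; lia.
have sub : finset.setX lowL hiR \subset noninversions w.
  by apply/fintype.subsetP => -[x y]; rewrite !inE /=; lia.
apply: leq_trans (subset_leq_card sub); rewrite cardsX expnS expn1.
by apply: leq_mul; lia.
Qed.

Lemma crossed_stationary_sum a l : (a.*2 <= n)%N ->
  \sum_(w in [set w : 'S_n | (crossed a w <= l)%N]) stationary_dist theta n w <=
  n`!%:R * theta ^+ ((a - l) ^ 2).
Proof.
move=> an.
have le w : w \in [set w : 'S_n | (crossed a w <= l)%N] ->
    stationary_dist theta n w <= theta ^+ ((a - l) ^ 2).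
  rewrite inE => wl; apply: le_trans (stationary_dist_le w) _.
  apply: ler_wiXn2l => //; first exact: ltW.
  apply: leq_trans (noninversions_ge w an).
  by rewrite leq_exp2r// leq_sub2l.
apply: le_trans (ler_sum _ le) _; rewrite sumr_const -[leLHS]mulr_natl.
rewrite ler_wpM2r ?exprn_ge0 ?(ltW theta_gt0)// ler_nat.
by rewrite -card_Sn; apply: leq_trans (max_card _) _.
Qed.
End StationaryMass.

(** * Asymptotics *)

Section Asymptotics.
Variables (R : realType) (theta : R).
Hypotheses (theta_gt0 : 0 < theta).

Lemma fact_le_exp n : (n`! <= n ^ n)%N.
Proof.
elim: n => // -[//|n] IHn; rewrite factS expnS leq_mul2l /=.
by apply: leq_trans IHn _; rewrite leq_exp2r.
Qed.

(** With T = - ln theta, ln (n`!) is at most n ln n, which is at most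
   (T / 32) n^2 + O(n), whereas the second factor has logarithm close to
   - (T / 16) n^2. *)
Lemma fact_geom_small : theta < 1 -> exists N, forall n, (N <= n)%N ->
  n`!%:R * theta ^+ ((n %/ 4) ^ 2) <= n.+1%:R^-1 :> R.
Proof.
move=> theta_lt1; pose T := - ln theta.
have T0 : 0 < T by rewrite oppr_gt0 ln_lt0// theta_gt0.
have tE : theta = expR (- T) by rewrite opprK lnK.
pose s := T / 32; have s0 : 0 < s by rewrite divr_gt0.
pose C := 1 - ln s + 6 * T / 16.
exists (Num.bound `|32 * C / T| + 3)%N => n Nn.
have nC : C <= T * n%:R / 32.
  have := archi_boundP (normr_ge0 (32 * C / T)) => le_bound.
  have : 32 * C / T <= n%:R.
    apply: le_trans (ler_norm _) _; apply: le_trans (ltW le_bound) _.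
    by rewrite ler_nat (leq_trans _ Nn)// leq_addr.
  by rewrite ler_pdivrMr// => ?; nra.
have n3 : 3 <= n%:R :> R by rewrite ler_nat (leq_trans _ Nn)// leq_addl.
set q := (n %/ 4)%N.
have qn : n%:R <= 4 * q%:R + 3 :> R.
  by rewrite -[4]/(4%:R) -[3]/(3%:R) -natrM -natrD ler_nat /q; lia.
have nn : n`!%:R <= expR (s * n%:R ^+ 2 - n%:R * ln s).
  have nE : n%:R <= expR (s * n%:R - ln s).
    rewrite expRB lnK ?posrE// ler_pdivlMr// mulrC.
    by have := @expR_ge1Dx R (s * n%:R); lra.
  apply: le_trans (_ : (n%:R : R) ^+ n <= _).
    by rewrite -natrX ler_nat fact_le_exp.
  apply: le_trans (_ : expR (s * n%:R - ln s) ^+ n <= _).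
    by rewrite lerXn2r ?nnegrE ?expR_ge0.
  rewrite -expRM_natl ler_expR; lra.
have -> : theta ^+ (q ^ 2) = expR (- (T * q%:R ^+ 2)).
  by rewrite tE -expRM_natl natrX mulrC mulNr.
apply: le_trans (ler_wpM2r (expR_ge0 _) nn) _.
rewrite -expRD.
apply: le_trans (_ : expR (- n%:R) <= _); last first.
  by rewrite expRN lef_pV2 ?posrE ?expR_gt0// -natr1 addrC expR_ge1Dx.
rewrite ler_expR.
have : (n%:R - 3) ^+ 2 / 16 <= q%:R ^+ 2 :> R by nra.
set x := n%:R in n3 qn nC *; set y := q%:R => yx.
have : T * ((x - 3) ^+ 2 / 16) <= T * y ^+ 2 by rewrite ler_pM2l.
have : C * x <= T * x / 32 * x by rewrite ler_wpM2r//; lra.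
rewrite /C /s; nra.
Qed.

(** For theta = 1 every step is deterministic, and a scan is a word followed by its
   reversal. *)
Lemma scan1 n (w w' : 'S_n) : systematic_scan (1 : R) n w w' = trans_id R w w'.
Proof.
have det t u v : foldr (@trans_comp R 'S_n) (@trans_id R 'S_n)
    [seq metropolis_step 1 i | i <- t] u v
    = (\prod_(i <- rev t) simple_tperm i * u == v)%g%:R.
  elim: t u v => [|i t IHt] u v /=; first by rewrite big_nil mul1g.
  rewrite /trans_comp (bigD1 (simple_tperm i * u)%g)//= big1 => [|z zu].
    rewrite addr0 IHt metropolis_stepE rev_cons -cats1 big_cat big_seq1 /= mulgA eqxx.
    by case: ifP; rewrite ?subrr ?mul0r ?addr0 ?mul1r.
  by rewrite metropolis_stepE (negbTE zu) subrr mul0r mulr0 addr0 if_same mul0r.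
rewrite /systematic_scan det /scan_order rev_cat revK big_cat /=.
suff -> : (\prod_(i <- enum 'I_n.-1) simple_tperm i *
           \prod_(i <- rev (enum 'I_n.-1)) simple_tperm i = 1)%g by rewrite mul1g.
elim: (enum _) => [|i t IHt]; first by rewrite !big_nil mulg1.
rewrite rev_cons -cats1 big_cat big_seq1 big_cons /= -mulgA (mulgA (\prod_(_ <- t) _))%g.
by rewrite IHt mul1g simple_tpermK.
Qed.

Lemma trans_pow1 n l (w w' : 'S_n) :
  trans_pow (systematic_scan (1 : R) n) l w w' = trans_id R w w'.
Proof.
elim: l w w' => // l IHl w w'; rewrite /trans_pow iterS -/(trans_pow _ l) /trans_comp.
rewrite (bigD1 w)//= IHl scan1 {1}/trans_id eqxx mul1r big1 ?addr0// => u uw.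
by rewrite IHl /trans_id eq_sym (negbTE uw) mul0r.
Qed.

Lemma tv_scan_lower (l : nat -> nat) : theta <= 1 ->
  (forall n, (2 <= n)%N -> (l n)%:R <= n%:R / 4 :> R) ->
  exists N, forall n, (N <= n)%N ->
    1 - n.+1%:R^-1 <=
      tv_dist (trans_pow (systematic_scan theta n) (l n) 1%g) (stationary_dist theta n).
Proof.
rewrite le_eqVlt => /predU1P[->|theta_lt1] ln4.
  exists 3%N => n n3; apply: le_trans (tv_dist_ge _ _ [set 1%g]).
  rewrite !big_set1 trans_pow1 /trans_id eqxx /stationary_dist.
  rewrite expr1n invr1 mul1r (eq_bigr (fun=> 1)) => [|w _]; last by rewrite expr1n invr1.
  rewrite sumr_const [#|_|](card_Sn n).
  apply: le_trans (ler_norm _); rewrite lerD2l lerN2 lef_pV2 ?posrE ?ltr0n ?fact_gt0//.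
  rewrite ler_nat; case: n n3 => // n n3; rewrite factS.
  have : (1 < n`!)%N by apply: (leq_trans _ (fact_geq n)).
  by nia.
have [N fN] := fact_geom_small theta_lt1; exists (maxn N 2) => n.
rewrite geq_max => /andP[Nn n2].
have l4 : (4 * l n <= n)%N.
  by have := ln4 n n2; rewrite ler_pdivlMr// -natrM ler_nat mulnC.
pose A := [set w : 'S_n | (crossed n./2 w <= l n)%N].
apply: le_trans (tv_dist_ge _ _ A); apply: le_trans (ler_norm _).
rewrite crossed_pow_sum//; [|by lia|exact: ltW].
rewrite lerD2l lerN2; apply: le_trans (crossed_stationary_sum _ _ _ _) _ => //.
- exact: ltW.
- by lia.
apply: le_trans (fN n Nn); rewrite ler_wpM2l//.
by apply: ler_wiXn2l; rewrite ?ltW// leq_exp2r//; lia.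
Qed.

End Asymptotics.

(** * The two bounds *)

Unset Implicit Arguments.
Local Open Scope classical_set_scope.
Local Open Scope ring_scope.

Theorem theorem1p4 (R : realType) (theta : R)
    (theta_gt0 : 0 < theta) (theta_le1 : theta <= 1) :
  (forall (n : nat) (c : R) (l : nat),
     (2 <= n)%N -> theta < 1 -> 0 < c ->
     l%:R = n%:R / 2 - ln n%:R / ln theta + c ->
     tv_dist (trans_pow (systematic_scan theta n) l 1%g) (stationary_dist theta n)
       ^+ 2
     <= (expR (theta `^ (2 * c + 1)) - 1)
        + (n`!)%:R
          * theta `^ (n%:R ^+ 2 / 8 - n%:R * ln n%:R / ln theta
                      + n%:R * (c + 1 / 4)))
  /\
  (forall l : nat -> nat,
     (forall n : nat, (2 <= n)%N -> (l n)%:R <= n%:R / 4 :> R) ->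
     tv_dist (trans_pow (systematic_scan theta n) (l n) 1%g)
       (stationary_dist theta n) @[n --> \oo] --> (1 : R)).
Proof.
split=> [n c l n2 theta_lt1 c0 lE|l ln4].
  have n0 : (0 < n)%N by exact: ltnW.
  rewrite -[leLHS]addr0 lerD ?mulr_ge0 ?powR_ge0//.
  (* The hypothesis on l says exactly that the x of scan_tv_le is theta^(2c+1). *)
  apply: scan_tv_le => //.
  pose T := ln theta; have T0 : T != 0 by rewrite lt_eqF// ln_lt0// theta_gt0.
  have tE : theta = expR T by rewrite lnK.
  have nE : n%:R = expR (ln n%:R) :> R by rewrite lnK// posrE ltr0n.
  rewrite /powR gt_eqF// -/T [in RHS]nE tE -!expRM_natl -expRN -!expRD.
  congr expR; rewrite natrM lE -/T -subn1 natrB// .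
  by field.
have [N tvN] := tv_scan_lower theta_gt0 theta_le1 ln4.
apply: (@squeeze_cvgr _ _ _ _ (fun n => 1 - n.+1%:R^-1) (fun=> 1)).
- exists (maxn N 1) => // n /= ; rewrite geq_max => /andP[Nn n1].
  rewrite tvN//=; have [K0 K1] := stochastic_pow n theta_gt0 theta_le1 (l n).
  apply: tv_dist_le1 => // [|w]; first exact: stationary_dist_sum.
  exact/ltW/stationary_dist_gt0.
- rewrite -[X in _ --> X]subr0; apply: cvgB; first exact: cvg_cst.
  exact: cvg_harmonic.
- exact: cvg_cst.
Qed.
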